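(* There exists a family of non-c-connected flat clustered graphs $C(G,T)$ whose underlying graph $G$ is a matching on $n$ vertices, for arbitrarily large $n$, such that $\alpha\in\Omega(n^2)$ in every $\langle\alpha,0,0\rangle$-drawing of $C(G,T)$.
   Context: A clustered graph $C(G,T)$ consists of a graph $G$ and a rooted tree $T$ whose leaves are exactly the vertices of $G$; each internal node $\mu$ of $T$ is a cluster, identified with the set of leaves of its subtree. $C(G,T)$ is c-connected if for every cluster the subgraph of $G$ induced by its vertices is connected; it is flat if no cluster other than the root contains another cluster. A drawing of $C(G,T)$ maps vertices to distinct points, edges to open curves between their endpoints, and each cluster $\mu$ to a simple closed region $R(\mu)$ containing all and only the vertices of $\mu$, with $R(\nu)\supseteq R(\mu)$ whenever $\mu$ is a descendant of $\nu$. Intersections among curves are isolated points, no three curves meet at a point, and two curves alternate around each intersection point. Edge-edge crossings are crossings between two edges; an edge crossing the boundary of $R(\mu)$ exactly $k$ times contributes $\lfloor k/2\rfloor$ edge-region crossings; for clusters $\mu,\nu$ neither an ancestor of the other, the number of region-region crossings is the number of connected components of $R(\mu)\setminus R(\nu)$ minus one. An $\langle\alpha,0,0\rangle$-drawing is a drawing with exactly $\alpha$ edge-edge crossings and no edge-region or region-region crossings. *)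

(* Defs.v *)
From mathcomp Require Import all_boot all_order all_algebra.
From mathcomp Require Import all_classical all_reals all_analysis.

Set Implicit Arguments.
Unset Strict Implicit.
Unset Printing Implicit Defensive.

Import Order.TTheory GRing.Theory Num.Theory.
Import numFieldNormedType.Exports.

Local Open Scope ring_scope.

(* The nodes of the tree are [inl v] (the leaves, i.e. the vertices of the graph)
   and [inr mu] (the internal nodes, i.e. the clusters). The root is made its own
   parent so that [cg_parent] is total; [cg_reach] makes the structure a tree
   rooted at [cg_root], and [cg_internal] says that clusters are not leaves. *)
Record clustered_graph := ClusteredGraph {
  cg_vertex : finType;
  cg_edges : {set {set cg_vertex}};
  cg_cluster : finType;
  cg_root : cg_cluster;
  cg_parent : cg_vertex + cg_cluster -> cg_cluster;
  cg_edges_card : forall e, e \in cg_edges -> #|e| = 2%N;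
  cg_parent_root : cg_parent (inr cg_root) = cg_root;
  cg_reach : forall mu, exists k, iter k (cg_parent \o inr) mu = cg_root;
  cg_internal : forall mu, exists x, x <> inr cg_root /\ cg_parent x = mu
}.

Section ClusteredGraph.
Variable C : clustered_graph.

Definition num_vertices : nat := #|cg_vertex C|.

Definition ancestor (nu mu : cg_cluster C) : bool :=
  fconnect (@cg_parent C \o inr) mu nu.

Definition cluster_vertices (mu : cg_cluster C) : {set cg_vertex C} :=
  [set v : cg_vertex C | ancestor mu (cg_parent (inl v))]%SET.

Definition induced_edge (A : {set cg_vertex C}) : rel (cg_vertex C) :=
  fun u v => [&& u \in A, v \in A & [set u; v]%SET \in cg_edges C].

Definition c_connected : Prop :=
  forall mu u v, u \in cluster_vertices mu -> v \in cluster_vertices mu ->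
    connect (induced_edge (cluster_vertices mu)) u v.

Definition flat : Prop :=
  forall mu nu : cg_cluster C, mu <> cg_root C -> ancestor mu nu -> nu = mu.

Definition is_matching : Prop :=
  forall v : cg_vertex C, exists! e, e \in cg_edges C /\ v \in e.

End ClusteredGraph.

Local Open Scope classical_set_scope.
Local Open Scope card_scope.

Section Plane.
Variable R : realType.
Notation plane := (R * R)%type.

Definition unit_disk : set plane := [set q | q.1 ^+ 2 + q.2 ^+ 2 <= 1].

(* The disk is compact, so such a map is a homeomorphism onto its image. *)
Definition disk_embedding (phi : plane -> plane) : Prop :=
  {within unit_disk, continuous phi} /\ set_inj unit_disk phi.

Definition simple_closed_region (A : set plane) : Prop :=
  exists phi, disk_embedding phi /\ A = phi @` unit_disk.

Definition boundary (A : set plane) : set plane := closure A `\` A°.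

(* The four branches of [A] and [B] at [p] alternate in the circular order around
   [p]: up to a homeomorphism of a neighbourhood of [p] onto the disk, [A] is the
   horizontal diameter and [B] the vertical one. *)
Definition alternate_at (A B : set plane) (p : plane) : Prop :=
  exists psi, [/\ disk_embedding psi, psi (0, 0) = p,
    nbhs p (psi @` unit_disk) &
    forall q, unit_disk q -> (A (psi q) <-> q.2 = 0) /\ (B (psi q) <-> q.1 = 0)].

End Plane.

Record drawing (R : realType) (C : clustered_graph) := Drawing {
  dr_point : cg_vertex C -> R * R;
  dr_path : {set cg_vertex C} -> R -> R * R;
  dr_region : cg_cluster C -> set (R * R)
}.

Section Drawing.
Variables (R : realType) (C : clustered_graph) (D : drawing R C).

Definition edge_curve (e : {set cg_vertex C}) : set (R * R) :=
  dr_path D e @` `]0, 1[.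

Definition region_boundary (mu : cg_cluster C) : set (R * R) :=
  boundary (dr_region D mu).

(* The curves of a drawing are its edges and the boundaries of its regions. *)
Definition curve_index : set ({set cg_vertex C} + cg_cluster C) :=
  [set x | if x is inl e then e \in cg_edges C else true].

Definition curve (x : {set cg_vertex C} + cg_cluster C) : set (R * R) :=
  match x with inl e => edge_curve e | inr mu => region_boundary mu end.

Record is_drawing : Prop := IsDrawing {
  dr_point_inj : injective (dr_point D);
  dr_path_continuous : forall e, e \in cg_edges C ->
    {within `[0, 1], continuous (dr_path D e)};
  dr_path_inj : forall e, e \in cg_edges C -> set_inj `[0, 1] (dr_path D e);
  dr_path_ends : forall e, e \in cg_edges C ->
    [set dr_path D e 0; dr_path D e 1] = dr_point D @` [set` e];
  dr_path_avoid : forall e v, e \in cg_edges C -> ~ edge_curve e (dr_point D v);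
  dr_region_simple : forall mu, simple_closed_region (dr_region D mu);
  dr_region_vertices : forall mu v,
    dr_region D mu (dr_point D v) <-> v \in cluster_vertices mu;
  dr_region_nested : forall mu nu, ancestor nu mu ->
    dr_region D mu `<=` dr_region D nu;
  dr_isolated : forall x y p, curve_index x -> curve_index y -> x <> y ->
    (curve x `&` curve y) p -> isolated (curve x `&` curve y) p;
  dr_no_three : forall x y z p,
    curve_index x -> curve_index y -> curve_index z ->
    x <> y -> x <> z -> y <> z -> ~ (curve x `&` curve y `&` curve z) p;
  dr_alternate : forall x y p, curve_index x -> curve_index y -> x <> y ->
    (curve x `&` curve y) p -> alternate_at (curve x) (curve y) p
}.

(* By [dr_no_three] and [dr_alternate], crossings between two edges correspond
   bijectively to the points lying on two distinct edges. *)
Definition edge_edge_crossings (alpha : nat) : Prop :=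
  [set p | exists e f, [/\ e \in cg_edges C, f \in cg_edges C, e <> f &
    (edge_curve e `&` edge_curve f) p]] #= `I_alpha.

Definition edge_region_crossings (e : {set cg_vertex C}) (mu : cg_cluster C)
    (beta : nat) : Prop :=
  exists k, (edge_curve e `&` region_boundary mu) #= `I_k /\ beta = k./2.

Definition components (A : set (R * R)) : set (set (R * R)) :=
  connected_component A @` A.

Definition region_region_crossings (mu nu : cg_cluster C) (gamma : nat) : Prop :=
  components (dr_region D mu `\` dr_region D nu) #= `I_gamma.+1.

Definition is_alpha00_drawing (alpha : nat) : Prop :=
  [/\ is_drawing,
      edge_edge_crossings alpha,
      forall e mu, e \in cg_edges C -> edge_region_crossings e mu 0 &
      forall mu nu, ~~ ancestor mu nu -> ~~ ancestor nu mu ->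
        region_region_crossings mu nu 0].

End Drawing.

(* Main.v *)
(** Blow up [K_5]: each vertex becomes a cluster and each edge a bundle of [p]
    parallel edges between the two clusters, [p] a prime.  In a drawing without
    edge-region and region-region crossings, choosing one edge from each bundle always
    gives two chosen edges that meet.  The choices [e |-> x + r_e y] over the field
    with [p] elements are determined by their values on any two bundles, and no three
    edges meet at a point, so the [p^2] pairs [(x, y)] yield distinct crossings, while
    there are only [20 p] vertices.

    That two chosen edges meet is the van Kampen argument for [K_5], with intersection
    numbers defined by angles: for maps [f], [g] of disks the variation of the direction
    of [f s - g t] along the boundary of a product of two paths vanishes as soon as [f]
    and [g] are disjoint on a connected set joining the ends of the first path.  An edge
    of the topological [K_5] runs inside the region of a cluster, along a chosen edge,
    and inside the second region.  Regions of two clusters may overlap, but their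
    difference is connected, which makes their contribution vanish too.  An edge cannot
    meet the region of a third cluster: it would cross the boundary exactly once,
    although both its ends lie outside. *)

Require Import Defs.
From mathcomp Require Import all_boot all_order all_algebra.
From mathcomp Require Import all_classical all_reals all_analysis.
From mathcomp Require Import ring lra zify.

Set Implicit Arguments.
Unset Strict Implicit.
Unset Printing Implicit Defensive.

Import Order.TTheory GRing.Theory Num.Theory.
Import numFieldNormedType.Exports.

Local Open Scope ring_scope.
Local Open Scope classical_set_scope.
Local Open Scope card_scope.

(** * Angles *)

Section Angles.
Variable R : realType.
Notation plane := (R * R)%type.
Implicit Types (t : R) (z w : plane).

Definition dotp z w : R := z.1 * w.1 + z.2 * w.2.
Definition crossp z w : R := z.1 * w.2 - z.2 * w.1.
(** The signed angle from [z] to [w], provided that it is less than a right angle, that is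
    [0 < dotp z w]. *)
Definition turn z w : R := atan (crossp z w / dotp z w).

(** A relation, because an argument is determined only modulo [2 pi] and a continuous lift may leave
    any fixed range. *)
Definition polar t z : Prop := exists2 r, 0 < r & z = (r * cos t, r * sin t).

Lemma polar_turn t z w : polar t z -> 0 < dotp z w -> polar (t + turn z w) w.
Proof.
move=> [r r0 zE] d0; rewrite /turn; set x := crossp z w / dotp z w.
have a1 := atan_gtNpi2 x; have a2 := atan_ltpi2 x.
have k0 : 0 < cos (atan x) by apply: cos_gt0_pihalf; rewrite a1 a2.
have sE : sin (atan x) = x * cos (atan x).
  by rewrite -[X in X * _]atanK /tan divfK// gt_eqF.
exists (dotp z w / (r * cos (atan x))); first by rewrite divr_gt0// mulr_gt0.
rewrite cosD sinD sE; move: (cos (atan x)) k0 {sE a1 a2} => k k0.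
rewrite {}/x /crossp; move: d0; rewrite /dotp zE /=; have := cos2Dsin2 t.
move: (cos t) (sin t) => c s cs1; case: w => w1 w2 /= d0.
have rn0 : r != 0 by rewrite gt_eqF.
have kn0 : k != 0 by rewrite gt_eqF.
have c2 : c ^+ 2 = 1 - s ^+ 2 by rewrite -cs1 addrK.
(* [E1] and [E2] expand [w] in the orthonormal frame [(c, s)], [(- s, c)]. *)
have E1 : c * (c * w1 + s * w2) - s * (c * w2 - s * w1) = w1 by ring: c2.
have E2 : s * (c * w1 + s * w2) + c * (c * w2 - s * w1) = w2 by ring: c2.
congr pair; [rewrite -[LHS]E1|rewrite -[LHS]E2];
  by field; rewrite rn0 kn0 gt_eqF.
Qed.

Lemma polar_opp t z : polar t z -> polar (t + pi) (- z).
Proof.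
move=> [r r0 ->]; exists r => //.
by rewrite cosDpi sinDpi !mulrN.
Qed.

(** Some axis direction has a positive dot product with [z], and a turn from it reaches [z]. *)
Lemma polar_exists z : z <> 0 -> exists t, polar t z.
Proof.
move=> z0.
have [x0|x0|x0] := ltgtP z.1 0.
- have P : polar pi (-1, 0) by exists 1 => //; rewrite cospi sinpi !mul1r.
  by eexists; apply: (polar_turn P); rewrite /dotp /=; lra.
- have P : polar 0 (1, 0) by exists 1 => //; rewrite cos0 sin0 !mul1r.
  by eexists; apply: (polar_turn P); rewrite /dotp /=; lra.
have P : polar (pi / 2) (0, 1).
  by exists 1 => //; rewrite cos_pihalf sin_pihalf !mul1r.
have [y0|y0|y0] := ltgtP z.2 0.
- have Q : polar (- (pi / 2)) (0, -1).
    by exists 1 => //; rewrite cosN sinN cos_pihalf sin_pihalf !mul1r.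
  by eexists; apply: (polar_turn Q); rewrite /dotp /=; lra.
- by eexists; apply: (polar_turn P); rewrite /dotp /=; lra.
by case: z0; rewrite [z]surjective_pairing x0 y0.
Qed.

Lemma cosD2piz t (n : int) : cos (t + n%:~R * (pi *+ 2)) = cos t.
Proof.
have H m : forall t, cos (t + m%:R * (pi *+ 2)) = cos t.
  by move=> u; rewrite mulr_natl periodicn//; exact: cosD2pi.
case: n => n; first by rewrite -pmulrn H.
by rewrite NegzE mulrNz -(H n.+1) -pmulrn mulNr subrK.
Qed.

Lemma polarD2piz t (n : int) z :
  polar t z -> polar (t + n%:~R * (pi *+ 2)) z.
Proof.
move=> [r r0 ->]; exists r => //; congr (_ * _, _ * _).
  by rewrite cosD2piz.
have := cosD2piz (t - pi / 2) n.
by rewrite addrAC !cosBpihalf.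
Qed.

(** Removing whole periods leaves [y] in [[0, 2 pi[]; either [y] or its reflection [2 pi - y] lies
    in [[0, pi]], where the cosine is injective. *)
Lemma cos_eq1 t : cos t = 1 -> exists n : int, t = n%:~R * (pi *+ 2).
Proof.
move=> c1; have p0 : 0 < pi :> R := pi_gt0 R.
have p20 : 0 < pi *+ 2 :> R by rewrite pmulrn_lgt0.
pose n := Num.floor (t / (pi *+ 2)); exists n.
have /andP[l u] : n%:~R <= t / (pi *+ 2) < (n + 1)%:~R by rewrite Num.Theory.floor_itv ?num_real.
rewrite ler_pdivlMr// in l; rewrite ltr_pdivrMr// intrD mulrDl mul1r in u.
set y := t - n%:~R * (pi *+ 2).
have y0 : 0 <= y by rewrite subr_ge0.
have cy : cos y = 1 by rewrite /y -mulNr -mulrNz cosD2piz.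
suff: y = 0 by move/eqP; rewrite subr_eq0 => /eqP.
have y2 : y < pi *+ 2 by rewrite ltrBlDl.
have [yp|yp] := leP y pi.
  by apply: cos_inj; rewrite ?cos0// in_itv/= ?lexx ?y0 ?yp ?ltW.
have c2 : cos (pi *+ 2 - y) = 1.
  by rewrite cosB cos2pi sin2pi cy mulr1 mul0r addr0.
have : pi *+ 2 - y = 0.
  apply: cos_inj; rewrite ?cos0 ?c2// in_itv/=; last by rewrite lexx ltW.
  by move: y2 yp; rewrite mulr2n => *; apply/andP; split; lra.
by move: yp; rewrite mulr2n; lra.
Qed.

Lemma polar_unique t t' z : polar t z -> polar t' z ->
  exists n : int, t' - t = n%:~R * (pi *+ 2).
Proof.
move=> [r r0 ->] [r' r'0 [E1 E2]]; apply: cos_eq1; rewrite cosB.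
have := cos2Dsin2 t; have := cos2Dsin2 t'.
move: (cos t) (sin t) (cos t') (sin t') E1 E2 => a b c d E1 E2 cd ab.
have a2 : a ^+ 2 = 1 - b ^+ 2 by rewrite -ab addrK.
have rr : r = r'.
  apply/eqP; rewrite -(@eqrXn2 _ 2) ?ltW//; apply/eqP.
  transitivity ((r * a) ^+ 2 + (r * b) ^+ 2); last first.
    have c2 : c ^+ 2 = 1 - d ^+ 2 by rewrite -cd addrK.
    by rewrite E1 E2; ring: c2.
  by ring: a2.
move: E1 E2; rewrite -rr => /mulfI; rewrite gt_eqF// => /(_ isT) <-.
by move=> /mulfI; rewrite gt_eqF// => /(_ isT) <-; ring: a2.
Qed.

End Angles.

(** * Connected sets in the plane *)

Section PlaneTopology.
Variable R : realType.
Notation plane := (R * R)%type.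

Section Cvg.
Context {I : Type} {F : set_system I} {FF : Filter F}.
Implicit Types (f g : I -> plane) (z w : plane).

Lemma cvgfst (U V : topologicalType) (f : I -> U * V) (z : U * V) :
  f @ F --> z -> (f x).1 @[x --> F] --> z.1.
Proof. by move=> fz; apply: (cvg_comp _ _ fz); exact: cvg_fst. Qed.

Lemma cvgsnd (U V : topologicalType) (f : I -> U * V) (z : U * V) :
  f @ F --> z -> (f x).2 @[x --> F] --> z.2.
Proof. by move=> fz; apply: (cvg_comp _ _ fz); exact: cvg_snd. Qed.

Lemma cvg_dotp f g z w : f @ F --> z -> g @ F --> w ->
  dotp (f x) (g x) @[x --> F] --> dotp z w.
Proof.
by move=> fz gw; apply: cvgD; apply: cvgM; by [exact: cvgfst|exact: cvgsnd].
Qed.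

Lemma cvg_crossp f g z w : f @ F --> z -> g @ F --> w ->
  crossp (f x) (g x) @[x --> F] --> crossp z w.
Proof.
by move=> fz gw; apply: cvgB; apply: cvgM; by [exact: cvgfst|exact: cvgsnd].
Qed.

Lemma cvg_turn f g z w : f @ F --> z -> g @ F --> w -> dotp z w != 0 ->
  turn (f x) (g x) @[x --> F] --> turn z w.
Proof.
move=> fz gw zw.
apply: (@continuous_cvg _ _ _ F FF (fun x => crossp (f x) (g x) / dotp (f x) (g x))).
  exact: continuous_atan.
apply: cvgM; first exact: cvg_crossp.
by apply: cvgV => //; exact: cvg_dotp.
Qed.

End Cvg.

Lemma dotp_gt0 (z : plane) : z <> 0 -> 0 < dotp z z.
Proof.
move=> z0; rewrite /dotp -!expr2 lt_neqAle addr_ge0 ?sqr_ge0// andbT eq_sym.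
rewrite paddr_eq0 ?sqr_ge0// !sqrf_eq0; apply/negP => /andP[/eqP a /eqP b].
by apply: z0; rewrite [z]surjective_pairing a b.
Qed.

Definition segm (V : lmodType R) (a b : V) : R -> V := fun t => a + t *: (b - a).

Lemma segm_continuous (a b : plane) : continuous (segm a b).
Proof.
move=> t; apply: cvgD; first exact: cvg_cst.
by apply: cvgZ; [exact: cvg_id|exact: cvg_cst].
Qed.

Lemma segm_connected (a b : plane) : connected (segm a b @` `[0, 1]).
Proof.
apply: connected_continuous_connected; first exact: segment_connected.
by apply: continuous_subspaceT; exact: segm_continuous.
Qed.

Lemma segm0 (V : lmodType R) (a b : V) : segm a b 0 = a.
Proof. by rewrite /segm scale0r addr0. Qed.

Lemma segm1 (V : lmodType R) (a b : V) : segm a b 1 = b.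
Proof. by rewrite /segm scale1r addrC subrK. Qed.

Lemma segm_ends (a b : plane) :
  (segm a b @` `[0, 1]) a /\ (segm a b @` `[0, 1]) b.
Proof.
by split; [exists 0; rewrite ?segm0|exists 1; rewrite ?segm1] => //=;
  rewrite in_itv/= lexx ler01.
Qed.

Lemma star_connected (A : set plane) (a : plane) :
  (forall b, A b -> segm a b @` `[0, 1] `<=` A) -> connected A.
Proof.
move=> starA; have -> : A = \bigcup_(b in A) segm a b @` `[0, 1].
  apply/seteqP; split => [b Ab|b [c Ac]]; last exact: starA.
  by exists b => //; exact: (segm_ends a b).2.
apply: bigcup_connected; last by move=> *; exact: segm_connected.
by exists a => b _; exact: (segm_ends a b).1.
Qed.

Lemma plane_connected : connected [set: plane].
Proof. exact: (@star_connected _ 0). Qed.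

(** Two distinct values would differ by at least [2 pi], so the connected image would contain
    [h t + pi], which differs from [h t] by half a period. *)
Lemma connected_2piZ_constant (T : topologicalType) (S : set T) (h : T -> R) :
  connected S -> {within S, continuous h} ->
  (forall s t, S s -> S t -> exists n : int, h s - h t = n%:~R * (pi *+ 2)) ->
  forall s t, S s -> S t -> h s = h t.
Proof.
move=> cS ch hZ.
have le s t : S s -> S t -> h s <= h t.
  move=> Ss St; rewrite leNgt; apply/negP => lt.
  have /connected_intervalP itv := connected_continuous_connected cS ch.
  have p0 : 0 < pi :> R := pi_gt0 R.
  have p20 : 0 < pi *+ 2 :> R by rewrite pmulrn_lgt0.
  have [n hn] := hZ _ _ Ss St.
  have n1 : (1 <= n)%R.
    rewrite -gtz0_ge1 -(ltr0z R) -(@pmulr_lgt0 _ (pi *+ 2))//.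
    by rewrite -hn subr_gt0.
  have big : pi *+ 2 <= h s - h t.
    by rewrite hn ler_peMl ?ler1z// ltW.
  have [u Su hu] : (h @` S) (h t + pi).
    apply: (itv (h t) (h s)); [by exists t|by exists s|].
    by apply/andP; split; move: big; rewrite mulr2n; lra.
  have [m hm] := hZ _ _ Su St; move: hm; rewrite hu addrC addKr mulr2n => hm.
  have : (m%:~R * 2 - 1 : R) * pi = 0 
    by rewrite mulrBl mul1r -mulrA mulr_natl mulr2n -hm subrr.
  move=> /eqP; rewrite mulf_eq0 (gt_eqF p0) orbF subr_eq0 => /eqP m2.
  have : (m * 2)%:~R = 1%:~R :> R by rewrite intrM m2.
  move=> /eqP; rewrite eqr_int => /eqP; lia.
by move=> s t Ss St; apply/eqP; rewrite eq_le !le.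
Qed.

End PlaneTopology.

(** * The unit disk *)

Lemma within_comp_continuous (T U V : topologicalType) (A : set U) (r : T -> U)
    (g : U -> V) : continuous r -> (forall x, A (r x)) ->
  {within A, continuous g} -> continuous (g \o r).
Proof.
move=> cr Ar /subspace_continuousP cg x; apply: cvg_comp (cg _ (Ar x)) => B nB.
by apply: (@filterS _ (nbhs x) _ _ _ _ (cr x _ nB)) => y; apply; exact: Ar.
Qed.

Section Disk.
Variable R : realType.
Notation plane := (R * R)%type.
Notation disk := (@unit_disk R).
Implicit Types (f g : plane -> plane) (q z : plane).

Lemma sqnorm_continuous : continuous (fun q : plane => q.1 ^+ 2 + q.2 ^+ 2).
Proof.
move=> q; apply: cvgD; apply: cvgM.
- by apply: cvgfst; exact: cvg_id.
- by apply: cvgfst; exact: cvg_id.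
- by apply: cvgsnd; exact: cvg_id.
- by apply: cvgsnd; exact: cvg_id.
Qed.

Lemma unit_disk_compact : compact disk.
Proof.
have sqle1 (x y : R) : x ^+ 2 + y ^+ 2 <= 1 -> -1 <= x <= 1.
  by move=> h; apply/andP; split; nra.
apply: (@subclosed_compact _ _ (`[(-1 : R), 1] `*` `[(-1 : R), 1] : set plane)).
- have -> : disk = (fun q : plane => q.1 ^+ 2 + q.2 ^+ 2) @^-1` [set x | x <= 1] by [].
  apply: preimage_closed; first by move=> q _; exact: sqnorm_continuous.
  exact: closed_le.
- by apply: compact_setX; exact: segment_compact.
- move=> [x y]; rewrite /unit_disk /= => h; split => /=; rewrite in_itv/=.
    exact: (sqle1 x y).
  by apply: (sqle1 y x); rewrite addrC.
Qed.

Lemma unit_disk0 : disk 0.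
Proof. by rewrite /unit_disk /= expr0n addr0 ler01. Qed.

(** The radial retraction of the plane onto the disk. Composing with it extends maps of the disk to
    the plane, so that continuity need not be relative to a subset. *)
Definition retract_disk q : plane :=
  (Num.max 1 (Num.sqrt (q.1 ^+ 2 + q.2 ^+ 2)))^-1 *: q.

Lemma retract_disk_id q : disk q -> retract_disk q = q.
Proof.
rewrite /unit_disk /retract_disk /= => q1; rewrite max_l ?invr1 ?scale1r//.
by rewrite -sqrtr1 ler_sqrt.
Qed.

Lemma retract_disk_in q : disk (retract_disk q).
Proof.
rewrite /unit_disk /retract_disk /=.
set m := Num.max _ _; have m0 : 0 < m by rewrite lt_max ltr01.
rewrite !exprMn -mulrDr exprVn mulrC ler_pdivrMr ?exprn_gt0// mul1r.
rewrite -[leLHS]sqr_sqrtr ?addr_ge0 ?sqr_ge0// lerXn2r ?nnegrE ?sqrtr_ge0 ?(ltW m0)//.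
by rewrite /m le_max lexx orbT.
Qed.

Lemma retract_disk_continuous : continuous retract_disk.
Proof.
move=> q; apply: cvgZ; last exact: cvg_id.
apply: cvgV; first by rewrite gt_eqF// lt_max ltr01.
apply: (@continuous_max R plane (fun=> 1)
  (fun q : plane => Num.sqrt (q.1 ^+ 2 + q.2 ^+ 2)) q); first exact: cvg_cst.
by apply: continuous_comp; [exact: sqnorm_continuous|exact: sqrt_continuous].
Qed.

Lemma within_retract_disk (T : topologicalType) (g : plane -> T) :
  {within disk, continuous g} -> continuous (g \o retract_disk).
Proof.
apply: within_comp_continuous; first exact: retract_disk_continuous.
exact: retract_disk_in.
Qed.

(** By compactness there is a uniform step along rays from the origin in which the direction of [f]
    changes by less than a right angle. Adding up the turns along the ray to [q], from an argument
    of [f 0], gives the lift. *)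
Lemma disk_angle_lift f : continuous f -> (forall q, f q <> 0) ->
  exists th : plane -> R, forall q, disk q ->
    {for q, continuous th} /\ polar (th q) (f q).
Proof.
move=> cf f0.
have /compact_near_coveringP cov := compact_setX unit_disk_compact
  (@segment_compact R 0 1).
have {cov} near_pos : \forall e \near (0 : R), forall q (s : R),
    disk q -> 0 <= s <= 1 ->
    0 < dotp (f (s *: q)) (f ((s + e) *: q)).
  have := cov R (nbhs (0 : R))
    (fun e x => 0 < dotp (f (x.2 *: x.1)) (f ((x.2 + e) *: x.1)))
    (nbhs_filter _).
  move=> H; apply: filterS (H _) => [e K q s Dq s01|[q s] _ {H}].
    by apply: (K (q, s)); split => //=; rewrite in_itv.
  suff : \forall y \near (nbhs (q, s), nbhs (0 : R)),
      0 < dotp (f (y.1.2 *: y.1.1)) (f ((y.1.2 + y.2) *: y.1.1)) by [].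
  have FF : Filter (filter_prod (nbhs (q, s)) (nbhs (0 : R))).
    exact: filter_prod_filter.
  apply: (@cvgr_gt R _ _ FF _ (dotp (f (s *: q)) (f ((s + 0) *: q)))).
    have c1 : x.1 @[x --> (nbhs (q, s), nbhs (0 : R))] --> (q, s) by exact: cvg_fst.
    apply: cvg_dotp; apply: (continuous_cvg _ (@cf _)).
      by apply: cvgZ; [exact: (cvgsnd c1)|exact: (cvgfst c1)].
    apply: cvgZ; last exact: (cvgfst c1).
    by apply: cvgD; [exact: (cvgsnd c1)|exact: cvg_snd].
  by rewrite addr0; apply: dotp_gt0; exact: f0.
have [N posN] : exists N, forall q (s : R), disk q -> 0 <= s <= 1 ->
    0 < dotp (f (s *: q)) (f ((s + harmonic N) *: q)).
  by have [N] := @filter_ex _ \oo _ _ (@cvg_harmonic R _ near_pos); exists N.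
pose e : R := N.+1%:R^-1.
have step m q : disk q -> (m <= N)%N ->
    0 < dotp (f ((m%:R * e) *: q)) (f ((m.+1%:R * e) *: q)).
  move=> Dq mN; rewrite -natr1 mulrDl mul1r; apply: posN => //.
  rewrite mulr_ge0 ?invr_ge0//= ler_pdivrMr// mul1r ler_nat.
  exact: leqW.
have [t0 Ht0] := polar_exists (f0 0).
(* The total turn along the first [m] of the [N.+1] steps from the origin to [q]. *)
pose S m q := \sum_(k < m) turn (f ((k%:R * e) *: q)) (f ((k.+1%:R * e) *: q)).
have cscale (c : R) : continuous (fun q => f (c *: q)).
  by move=> q; apply: (continuous_cvg _ (@cf _)); exact: cvgZr.
have SP m q : disk q -> (m <= N.+1)%N ->
    {for q, continuous (S m)} /\ polar (t0 + S m q) (f ((m%:R * e) *: q)).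
  move=> Dq; elim: m => [_|m IH mN].
    rewrite /S big_ord0 addr0 mul0r scale0r; split => //.
    rewrite (_ : (fun=> _) = cst 0); first exact: cvg_cst.
    by apply/funext => x; rewrite big_ord0.
  have [cS pS] := IH (ltnW mN); have dp := step _ _ Dq mN.
  have SE x : S m.+1 x = S m x + turn (f ((m%:R * e) *: x)) (f ((m.+1%:R * e) *: x)).
    by rewrite /S big_ord_recr.
  split; last by rewrite SE addrA; exact: polar_turn.
  rewrite (_ : S m.+1 = fun x => S m x +
    turn (f ((m%:R * e) *: x)) (f ((m.+1%:R * e) *: x))); last exact/funext.
  apply: cvgD => //; apply: cvg_turn; [exact: cscale|exact: cscale|].
  by rewrite gt_eqF.
exists (fun q => t0 + S N.+1 q) => q Dq.
have [cS pS] := SP _ _ Dq (leqnn N.+1); split.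
  by apply: cvgD => //; exact: cvg_cst.
by move: pS; rewrite /e divff ?scale1r.
Qed.

End Disk.
Arguments retract_disk {R} q.

(** * Variation of an angle *)

Section Winding.
Variable R : realType.
Notation plane := (R * R)%type.
Notation disk := (@unit_disk R).
Implicit Types (f g : plane -> plane) (a b c d q z : plane).

(** These are the maps of the disk extended by [retract_disk]: statements range over the whole
    plane, while compactness of the disk remains available. *)
Definition disk_map g : Prop :=
  continuous g /\ forall q, g (retract_disk q) = g q.

Lemma disk_map_retract g :
  {within disk, continuous g} -> disk_map (g \o retract_disk).
Proof.
move=> cg; split; first exact: within_retract_disk.
by move=> q /=; rewrite (retract_disk_id (retract_disk_in q)).
Qed.

Definition angle_lift g z (th : plane -> R) : Prop :=
  continuous th /\ forall q, polar (th q) (g q - z).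

Lemma angle_lift_exists g z : disk_map g -> (forall q, g q <> z) ->
  exists th, angle_lift g z th.
Proof.
move=> [cg gr] gz.
have [||th thP] := @disk_angle_lift R (fun q => g q - z).
- by move=> q; apply: cvgB; [exact: cg|exact: cvg_cst].
- by move=> q /eqP; rewrite subr_eq0 => /eqP/gz.
exists (th \o retract_disk); split => q.
  apply: continuous_comp; first exact: retract_disk_continuous.
  exact: (thP _ (retract_disk_in q)).1.
by rewrite -gr; exact: (thP _ (retract_disk_in q)).2.
Qed.

Lemma angle_lift_unique g z th th' a b :
  angle_lift g z th -> angle_lift g z th' -> th b - th a = th' b - th' a.
Proof.
move=> [cth pth] [cth' pth'].
suff : th b - th' b = th a - th' a by lra.
apply: (@connected_2piZ_constant _ _ setT (fun q => th q - th' q)) => //.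
- exact: plane_connected.
- by apply: continuous_subspaceT => q; apply: cvgB; [exact: cth|exact: cth'].
move=> s t _ _.
have [n hn] := polar_unique (pth' s) (pth s).
have [m hm] := polar_unique (pth' t) (pth t).
by exists (n - m); rewrite hn hm intrB mulrBl.
Qed.

(** By [angle_lift_unique] the choice of the lift does not matter; the default [0] is taken only
    where no lift exists. *)
Definition angle_var g z a b : R :=
  let th := xget (fun=> 0) (angle_lift g z) in th b - th a.

Lemma angle_varE g z th a b :
  angle_lift g z th -> angle_var g z a b = th b - th a.
Proof.
move=> thP; rewrite /angle_var; case: xgetP => [th' _ th'P|/(_ th)//].
exact: angle_lift_unique th'P thP.
Qed.

(** For [z] near [z0] the directions to [g q] from both points are within a right angle, uniformly
    in [q]. A lift for [z0] corrected by the turn is then a lift for [z], and the correction tends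
    to [0]. *)
Lemma angle_var_cvg g z0 a b : disk_map g -> (forall q, g q <> z0) ->
  angle_var g z a b @[z --> z0] --> angle_var g z0 a b.
Proof.
move=> dg gz0; have [cg gr] := dg; have [th thP] := angle_lift_exists dg gz0.
have [cth pth] := thP.
have gz0' q : g q - z0 <> 0 by move=> /eqP; rewrite subr_eq0 => /eqP/gz0.
have near_pos : \forall z \near z0, forall q, 0 < dotp (g q - z0) (g q - z).
  have /compact_near_coveringP cov := @unit_disk_compact R.
  have H := cov plane (nbhs z0) (fun z q => 0 < dotp (g q - z0) (g q - z))
    (nbhs_filter _).
  apply: filterS (H _) => [z K q|q _ {H}].
    by rewrite -gr; apply: K; exact: retract_disk_in.
  suff : \forall y \near (nbhs q, nbhs z0),
      0 < dotp (g y.1 - z0) (g y.1 - y.2) by [].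
  have FF : Filter (filter_prod (nbhs q) (nbhs z0)) by exact: filter_prod_filter.
  apply: (@cvgr_gt R _ _ FF _ (dotp (g q - z0) (g q - z0))); last exact: dotp_gt0.
  have c1 : g x.1 @[x --> filter_prod (nbhs q) (nbhs z0)] --> g q.
    by apply: (continuous_cvg _ (@cg _)); exact: cvg_fst.
  apply: cvg_dotp; apply: cvgB => //; first exact: cvg_cst.
  exact: cvg_snd.
have lim q : turn (g q - z0) (g q - z) @[z --> z0] --> 0.
  have -> : 0 = turn (g q - z0) (g q - z0).
    by rewrite /turn /crossp [X in X - _]mulrC subrr mul0r atan0.
  apply: cvg_turn; first exact: cvg_cst.
    by apply: cvgB; [exact: cvg_cst|exact: cvg_id].
  by rewrite gt_eqF// dotp_gt0.
have : angle_var g z0 a b + (turn (g b - z0) (g b - z) - turn (g a - z0) (g a - z))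
    @[z --> z0] --> angle_var g z0 a b.
  have := cvgD (cvg_cst (angle_var g z0 a b)) (cvgB (lim b) (lim a)).
  by rewrite subrr addr0; apply.
apply: cvg_trans; apply: near_eq_cvg; near=> z.
have posz : forall q, 0 < dotp (g q - z0) (g q - z) by near: z.
have lz : angle_lift g z (fun q => th q + turn (g q - z0) (g q - z)).
  split=> q; last first.
    exact: polar_turn.
  apply: cvgD; first exact: cth.
  have gq : g x - z0 @[x --> q] --> g q - z0 by apply: cvgB; [exact: cg|exact: cvg_cst].
  apply: cvg_turn => //; first by apply: cvgB; [exact: cg|exact: cvg_cst].
  by rewrite gt_eqF.
rewrite (angle_varE _ _ thP) (angle_varE _ _ lz); lra.
Unshelve. all: by end_near.
Qed.

(* The left-hand side is the variation of the direction of [f s - g t] along the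
   boundary of the square [[a, b] x [c, d]], an intersection number; it is carried
   by the connected set [S], where [f] and [g] are disjoint. *)
Lemma angle_var_square f g a b c d (S : set plane) :
  disk_map f -> disk_map g -> connected S -> S a -> S b ->
  (forall s t, S s -> f s <> g t) ->
  (forall s, f s <> g c) -> (forall s, f s <> g d) ->
  angle_var f (g c) a b - angle_var f (g d) a b
  + angle_var g (f b) c d - angle_var g (f a) c d = 0.
Proof.
move=> df dg cS Sa Sb fg fc fd.
have [th1 th1P] := angle_lift_exists df fc.
have [th2 th2P] := angle_lift_exists df fd.
rewrite (angle_varE _ _ th1P) (angle_varE _ _ th2P).
pose h s := th1 s - th2 s + angle_var g (f s) c d.
suff : h b = h a by rewrite /h; lra.
have [[cth1 pth1] [cth2 pth2]] := (th1P, th2P).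
apply: (@connected_2piZ_constant _ _ S h) => //.
  apply/subspace_continuousP => s Ss.
  suff : {for s, continuous h} by exact: cvg_within_filter.
  apply: cvgD; first by apply: cvgB; [exact: cth1|exact: cth2].
  apply: (@cvg_comp _ _ _ f (fun z => angle_var g z c d) _ (nbhs (f s))).
    exact: df.1.
  by apply: angle_var_cvg => // t /esym; exact: fg.
(* Seen from [g c] and from [f s] the directions are opposite, so the angles differ by [pi] modulo
   [2 pi]; the same holds at [d], and the two shifts by [pi] cancel. *)
have hZ s : S s -> exists n : int, h s = n%:~R * (pi *+ 2).
  move=> Ss; have [|et etP] := @angle_lift_exists g (f s) dg.
    by move=> t /esym; exact: fg.
  rewrite /h (angle_varE _ _ etP); have [_ pet] := etP.
  have := polar_opp (pet c); rewrite opprB => /polar_unique/(_ (pth1 s))[n hn].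
  have := polar_opp (pet d); rewrite opprB => /polar_unique/(_ (pth2 s))[m hm].
  by exists (n - m); rewrite intrB mulrBl -hn -hm; lra.
move=> s t /hZ[n ->] /hZ[m ->]; exists (n - m).
by rewrite intrB mulrBl.
Qed.

End Winding.

(** * Nonplanarity of [K_5] *)

Section Parity.
Variable R : realType.
Notation plane := (R * R)%type.

(* Modulo [2 pi] the variation [a v i j] of the direction from [P v] along the edge
   [ij] only depends on the endpoints, up to an integer [n v i j].  Each [n v i j]
   enters two of the fifteen equations, whose sum is therefore the parity of the
   number of interleaved pairs of edges of the ordered [K_5], which is [5]. *)
Lemma K5_intersection_parity (P : nat -> plane) (a : nat -> nat -> nat -> R) :
  (forall u v, (u < v < 5)%N -> P u <> P v) ->
  (forall v i j, (v < 5)%N -> (i < j < 5)%N -> v != i -> v != j ->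
    exists t0 t1, [/\ polar t0 (P i - P v), polar t1 (P j - P v) &
      a v i j = t1 - t0]) ->
  (forall i j k l, (i < j < 5)%N -> (k < l < 5)%N -> uniq [:: i; j; k; l] ->
    a k i j - a l i j + a j k l - a i k l = 0) ->
  False.
Proof.
move=> Pinj aP cr.
have [th thP] : {th : nat * nat -> R & forall x, (x.1 < x.2 < 5)%N ->
    polar (th x) (P x.2 - P x.1)}.
  apply: (@choice _ _ (fun x t => (x.1 < x.2 < 5)%N -> polar t (P x.2 - P x.1))).
  move=> [u v] /=; have [uv|_] := boolP (u < v < 5)%N; last by exists 0.
  have [|t tP] := @polar_exists R (P v - P u); last by exists t.
  by move=> /eqP; rewrite subr_eq0 => /eqP/esym; exact: Pinj.
(* Defining the angle of the reversed edge as the old one plus [pi] makes [Th u v - Th v u] exactly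
   [pi] or [- pi], with no unknown multiple of [2 pi]. *)
pose Th u v := if (u < v)%N then th (u, v) else th (v, u) + pi.
have ThP u v : (u < 5)%N -> (v < 5)%N -> u != v -> polar (Th u v) (P v - P u).
  rewrite /Th; case: (ltngtP u v) => // uv u5 v5 _; first by apply: (thP (u, v)); rewrite /= uv.
  by rewrite -(opprB (P u)); apply/polar_opp/(thP (v, u)); rewrite /= uv.
pose sg u v : int := if (u < v)%N then -1 else 1.
have ThB u v : u != v -> Th u v - Th v u = (sg u v)%:~R * pi.
  by rewrite /Th /sg; case: (ltngtP u v) => // uv _; rewrite ?mulN1r ?mul1r; lra.
have [n nP] : {n : nat * nat * nat -> int & forall x,
    (x.1.1 < 5)%N -> (x.1.2 < x.2 < 5)%N -> x.1.1 != x.1.2 -> x.1.1 != x.2 ->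
    a x.1.1 x.1.2 x.2 = Th x.1.1 x.2 - Th x.1.1 x.1.2 + (n x)%:~R * (pi *+ 2)}.
  apply: (@choice _ _ (fun x m => (x.1.1 < 5)%N -> (x.1.2 < x.2 < 5)%N ->
    x.1.1 != x.1.2 -> x.1.1 != x.2 ->
    a x.1.1 x.1.2 x.2 = Th x.1.1 x.2 - Th x.1.1 x.1.2 + m%:~R * (pi *+ 2))).
  move=> [[v i] j] /=.
  have [/and4P[v5 ij vi vj]|N] := boolP [&& v < 5, i < j < 5, v != i & v != j]%N;
    last first.
    by exists 0 => v5 ij vi vj; case/negP: N; apply/and4P.
  have [t0 [t1 [p0 p1 ->]]] := aP _ _ _ v5 ij vi vj.
  have [ij' j5] := andP ij; have i5 := ltn_trans ij' j5.
  have [m0 h0] := polar_unique (ThP _ _ v5 i5 vi) p0.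
  have [m1 h1] := polar_unique (ThP _ _ v5 j5 vj) p1.
  by exists (m1 - m0) => _ _ _ _; rewrite intrB mulrBl -h1 -h0; lra.
have E i j k l : (i < j < 5)%N -> (k < l < 5)%N -> uniq [:: i; j; k; l] ->
    2 * (n (k, i, j) - n (l, i, j) + n (j, k, l) - n (i, k, l))
    + (sg k j - sg k i - sg l j + sg l i) = 0.
  move=> ij kl U; have := cr _ _ _ _ ij kl U.
  move: U; rewrite /= !inE !negb_or => /and4P[/and3P[_ ik il] /andP[jk jl] _ _].
  have [/andP[ij' j5] /andP[kl' l5]] := (ij, kl).
  have [i5 k5] := (ltn_trans ij' j5, ltn_trans kl' l5).
  rewrite (nP (k, i, j)) ?(nP (l, i, j)) ?(nP (j, k, l)) ?(nP (i, k, l))//=;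
    do ?by rewrite eq_sym.
  have h1 : Th k j - Th j k = (sg k j)%:~R * pi by apply: ThB; rewrite eq_sym.
  have h2 : Th k i - Th i k = (sg k i)%:~R * pi by apply: ThB; rewrite eq_sym.
  have h3 : Th l j - Th j l = (sg l j)%:~R * pi by apply: ThB; rewrite eq_sym.
  have h4 : Th l i - Th i l = (sg l i)%:~R * pi by apply: ThB; rewrite eq_sym.
  move=> H; apply/eqP; rewrite -(eqr_int R) mulr0z; apply/eqP.
  have p0 : pi != 0 :> R by rewrite gt_eqF// pi_gt0.
  apply: (mulIf p0); rewrite mul0r -{}H !(rmorphD, rmorphN, rmorphM)/= !mulr2n.
  by move: h1 h2 h3 h4; rewrite -!pmulrn; lra.
(* The fifteen pairs of disjoint edges. The [sg] term is [-2] for the five interleaved pairs, in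
   [E4], [E5], [E8], [E9] and [E14], and [0] for the others. *)
have E1 := E 0 1 2 3 isT isT isT.
have E2 := E 0 1 2 4 isT isT isT.
have E3 := E 0 1 3 4 isT isT isT.
have E4 := E 0 2 1 3 isT isT isT.
have E5 := E 0 2 1 4 isT isT isT.
have E6 := E 0 2 3 4 isT isT isT.
have E7 := E 0 3 1 2 isT isT isT.
have E8 := E 0 3 1 4 isT isT isT.
have E9 := E 0 3 2 4 isT isT isT.
have E10 := E 0 4 1 2 isT isT isT.
have E11 := E 0 4 1 3 isT isT isT.
have E12 := E 0 4 2 3 isT isT isT.
have E13 := E 1 2 3 4 isT isT isT.
have E14 := E 1 3 2 4 isT isT isT.
have E15 := E 1 4 2 3 isT isT isT.
move: E1 E2 E3 E4 E5 E6 E7 E8 E9 E10 E11 E12 E13 E14 E15; rewrite /sg /=.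
lia.
Qed.

End Parity.

(** * Edges of [K_5] routed through disks that may overlap *)

Section Core.
Variable R : realType.
Notation plane := (R * R)%type.
Notation disk := (@unit_disk R).
Implicit Types (f g : plane -> plane) (a b c d q z : plane).

Lemma angle_var_polar g z t a b : disk_map g -> (forall q, g q <> z) ->
  polar t (g a - z) -> polar (t + angle_var g z a b) (g b - z).
Proof.
move=> dg gz pt; have [th thP] := angle_lift_exists dg gz.
have [_ pth] := thP; have [n hn] := polar_unique (pth a) pt.
rewrite (angle_varE _ _ thP).
have -> : t + (th b - th a) = th b + n%:~R * (pi *+ 2) by rewrite -hn; lra.
exact: polarD2piz.
Qed.

Lemma angle_var_square_disjoint f g a b c d : disk_map f -> disk_map g ->
  (forall s t, f s <> g t) ->
  angle_var f (g c) a b - angle_var f (g d) a b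
  + angle_var g (f b) c d - angle_var g (f a) c d = 0.
Proof.
move=> df dg fg.
by apply: (@angle_var_square _ _ _ _ _ _ _ setT) => //; exact: plane_connected.
Qed.

(* [g i] parametrizes the region of the [i]-th cluster, [c i] is the place in it of the
   vertex [i] of [K_5], and [x i j] that of the end of the edge [e i j] (or [e j i]). *)
Lemma K5_disks_meet (g : nat -> plane -> plane) (c : nat -> plane)
    (x : nat -> nat -> plane) (e : nat -> nat -> plane -> plane) (u v : plane) :
  (forall i, (i < 5)%N -> disk_map (g i)) ->
  (forall i j, (i < j < 5)%N -> disk_map (e i j)) ->
  (forall i, (i < 5)%N -> disk (c i)) ->
  (forall i j, (i < 5)%N -> (j < 5)%N -> i != j -> disk (x i j)) ->
  (forall i j, (i < j < 5)%N ->
    e i j u = g i (x i j) /\ e i j v = g j (x j i)) ->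
  (forall i k, (i < 5)%N -> (k < 5)%N -> i != k ->
    forall s, g i (c i) <> g k s) ->
  (forall i j k, (i < 5)%N -> (j < 5)%N -> (k < 5)%N -> i != j -> i != k ->
    forall s, g i (x i j) <> g k s) ->
  (forall i k, (i < 5)%N -> (k < 5)%N -> i != k ->
    connected [set s | disk s /\ forall t, g i s <> g k t]) ->
  (forall i j k q s, (i < j < 5)%N -> (k < 5)%N -> k != i -> k != j ->
    e i j q <> g k s) ->
  (forall i j k l q s, (i < j < 5)%N -> (k < l < 5)%N -> uniq [:: i; j; k; l] ->
    e i j q <> e k l s) ->
  False.
Proof.
move=> dg de Dc Dx eE cP xP cS eg ee.
pose P k := g k (c k).
(* The route from [P i] to [P j] has three pieces: inside disk [i], along the edge, inside disk
   [j]. *)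
pose a w i j := angle_var (g i) (P w) (c i) (x i j)
  + angle_var (e i j) (P w) u v + angle_var (g j) (P w) (x j i) (c j).
apply: (@K5_intersection_parity R P a).
- by move=> i j /andP[ij j5]; apply: cP; rewrite ?(ltn_eqF ij)// (ltn_trans ij).
- move=> w i j w5 ij wi wj; have [ij' j5] := andP ij; have i5 := ltn_trans ij' j5.
  have [t tP] : exists t, polar t (P i - P w).
    apply: polar_exists => /eqP; rewrite subr_eq0 => /eqP.
    by apply: cP; rewrite // eq_sym.
  exists t, (t + a w i j); split => //; last by rewrite addrAC subrr add0r.
  rewrite /a 2!(addrA t); apply: angle_var_polar; first exact: dg.
    by move=> q /esym; apply: cP.
  rewrite -(eE _ _ ij).2; apply: angle_var_polar; first exact: de.
    by move=> q; apply: eg.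
  rewrite (eE _ _ ij).1; apply: angle_var_polar; first exact: dg.
    by move=> q /esym; apply: cP.
  by [].
move=> i j k l ij kl U.
move: (U); rewrite /= !inE !negb_or => /and4P[/and3P[nij ik il] /andP[jk jl] nkl _].
have [/andP[ij' j5] /andP[kl' l5]] := (ij, kl).
have [i5 k5] := (ltn_trans ij' j5, ltn_trans kl' l5).
have [ki [li [kj lj]]] : k != i /\ l != i /\ k != j /\ l != j.
  by rewrite !(eq_sym k) !(eq_sym l).
have [nji nlk] : j != i /\ l != k by rewrite ![_ == i]eq_sym ![_ == k]eq_sym.
have [eiju eijv] := eE _ _ ij; have [eklu eklv] := eE _ _ kl.
(* Disks [m] and [n] may overlap, but the part of the first one off the second is connected and
   contains [y1] and [y2], as [angle_var_square] requires. *)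
have dd m n y1 y2 z1 z2 : (m < 5)%N -> (n < 5)%N -> m != n ->
    disk y1 -> disk y2 ->
    (forall s, g m y1 <> g n s) -> (forall s, g m y2 <> g n s) ->
    (forall s, g n z1 <> g m s) -> (forall s, g n z2 <> g m s) ->
    angle_var (g m) (g n z1) y1 y2 - angle_var (g m) (g n z2) y1 y2
    + angle_var (g n) (g m y2) z1 z2 - angle_var (g n) (g m y1) z1 z2 = 0.
  move=> m5 n5 mn D1 D2 y1P y2P z1P z2P.
  apply: (angle_var_square (dg _ m5) (dg _ n5) (cS _ _ m5 n5 mn)) => //.
  - by move=> s t [_]; apply.
  - by move=> s /esym; exact: z1P.
  - by move=> s /esym; exact: z2P.
(* One equation for each of the nine pairs of a piece of the route [ij] with a piece of the route
   [kl]. The contributions at the junctions of pieces cancel in their sum, which is the equation for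
   the whole routes. *)
have E11 : _ = 0 := dd i k (c i) (x i j) (c k) (x k l) i5 k5 ik (Dc _ i5)
  (Dx _ _ i5 j5 nij) (cP _ _ i5 k5 ik) (xP _ _ _ i5 j5 k5 nij ik)
  (cP _ _ k5 i5 ki) (xP _ _ _ k5 l5 i5 nkl ki).
have E13 : _ = 0 := dd i l (c i) (x i j) (x l k) (c l) i5 l5 il (Dc _ i5)
  (Dx _ _ i5 j5 nij) (cP _ _ i5 l5 il) (xP _ _ _ i5 j5 l5 nij il)
  (xP _ _ _ l5 k5 i5 nlk li) (cP _ _ l5 i5 li).
have E31 : _ = 0 := dd j k (x j i) (c j) (c k) (x k l) j5 k5 jk
  (Dx _ _ j5 i5 nji) (Dc _ j5) (xP _ _ _ j5 i5 k5 nji jk) (cP _ _ j5 k5 jk)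
  (cP _ _ k5 j5 kj) (xP _ _ _ k5 l5 j5 nkl kj).
have E33 : _ = 0 := dd j l (x j i) (c j) (x l k) (c l) j5 l5 jl
  (Dx _ _ j5 i5 nji) (Dc _ j5) (xP _ _ _ j5 i5 l5 nji jl) (cP _ _ j5 l5 jl)
  (xP _ _ _ l5 k5 j5 nlk lj) (cP _ _ l5 j5 lj).
have E12 := @angle_var_square_disjoint (g i) (e k l) (c i) (x i j) u v (dg _ i5)
  (de _ _ kl) (fun s t h => @eg k l i t s kl i5 ik il (esym h)).
have E32 := @angle_var_square_disjoint (g j) (e k l) (x j i) (c j) u v (dg _ j5)
  (de _ _ kl) (fun s t h => @eg k l j t s kl j5 jk jl (esym h)).
have E21 := @angle_var_square_disjoint (e i j) (g k) u v (c k) (x k l) (de _ _ ij)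
  (dg _ k5) (fun s t => @eg i j k s t ij k5 ki kj).
have E23 := @angle_var_square_disjoint (e i j) (g l) u v (x l k) (c l) (de _ _ ij)
  (dg _ l5) (fun s t => @eg i j l s t ij l5 li lj).
have E22 := @angle_var_square_disjoint (e i j) (e k l) u v u v (de _ _ ij)
  (de _ _ kl) (fun s t => @ee i j k l s t ij kl U).
rewrite ?eiju ?eijv ?eklu ?eklv in E12 E32 E21 E23 E22.
rewrite /a /P; lra.
Qed.

End Core.

(** * Edges and regions *)

Section Regions.
Variable R : realType.
Notation plane := (R * R)%type.
Notation disk := (@unit_disk R).
Implicit Types (phi psi : plane -> plane) (A B Q : set plane).

Lemma plane_hausdorff : hausdorff_space plane.
Proof. exact: norm_hausdorff. Qed.

Lemma disk_image_closed phi (C : set plane) : {within disk, continuous phi} ->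
  closed C -> closed (phi @` (disk `&` C)).
Proof.
move=> cphi cC; apply: compact_closed; first exact: plane_hausdorff.
apply: continuous_compact; first exact: continuous_subspaceW cphi.
by apply: compact_closedI => //; exact: unit_disk_compact.
Qed.

Lemma region_closed A : simple_closed_region A -> closed A.
Proof.
move=> [phi [[cphi _] ->]].
by have := disk_image_closed cphi (@closedT _); rewrite setIT.
Qed.

(** An embedding of the compact disk maps closed sets to closed sets, so by injectivity a relatively
    clopen part of the preimage has a relatively clopen image in [B]. *)
Lemma embedding_preimage_connected phi B : disk_embedding phi ->
  B `<=` phi @` disk -> connected B -> connected [set s | disk s /\ B (phi s)].
Proof.
move=> [cphi iphi] Bsub cB U [s0 Us0] [V oV UV] [C cC UC].
have inj s t : disk s -> disk t -> phi s = phi t -> s = t.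
  by move=> Ds Dt; apply: iphi; rewrite inE.
have sub s : U s -> disk s /\ B (phi s) by rewrite UV => -[].
have img : phi @` U = B.
  apply: cB.
  - by exists (phi s0), s0.
  - exists (~` (phi @` (disk `&` ~` V))).
      by apply/closed_openC/disk_image_closed => //; exact: open_closedC.
    apply/seteqP; split => [_ [s Us <-]|p [Bp pN]].
      have [Ds Bs] := sub _ Us; split => // -[t [Dt Vt] /inj ts].
      by move: Us; rewrite UV -ts// => -[_ /Vt].
    have [s Ds sp] := Bsub _ Bp; exists s => //; rewrite UV; split.
      by split => //; rewrite sp.
    by apply: contrapT => nV; apply: pN; exists s.
  - exists (phi @` (disk `&` C)); first exact: disk_image_closed.
    apply/seteqP; split => [_ [s Us <-]|p [Bp [s [Ds Cs] sp]]].
      have [Ds Bs] := sub _ Us; split => //; exists s => //; split => //.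
      by move: Us; rewrite UC => -[].
    by exists s => //; rewrite UC; split => //; split => //; rewrite sp.
apply/seteqP; split => [s /sub//|s [Ds]].
by rewrite -img => -[t Ut /inj <-//]; have [] := sub _ Ut.
Qed.

(** Off its boundary the closed set [A] coincides with its interior, hence cuts out a relatively
    clopen part of [Q]. *)
Lemma connected_avoid_boundary A Q x y : closed A -> connected Q ->
  (forall z, Q z -> ~ boundary A z) -> Q x -> ~ A x -> Q y -> ~ A y.
Proof.
move=> cA cQ QN Qx Ax Qy Ay; apply: Ax.
suff QA : Q `&` A = Q by move: Qx; rewrite -QA => -[].
apply: cQ; [by exists y| |by exists A].
exists A°; first exact: open_interior.
apply/seteqP; split => z [Qz Az]; split => //; last exact: interior_subset Az.
apply: contrapT => nA; apply: (QN _ Qz); split => //.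
exact: subset_closure.
Qed.

Lemma disk_convex (a b : plane) t : disk a -> disk b -> 0 <= t <= 1 ->
  disk (segm a b t).
Proof.
case: a b => [a1 a2] [b1 b2]; rewrite /unit_disk /segm /= => Da Db /andP[t0 t1].
rewrite -[_ *: _]/(t * (b1 - a1)) -[_ *: (b2 - a2)]/(t * (b2 - a2)).
have -> : a1 + t * (b1 - a1) = (1 - t) * a1 + t * b1 by ring.
have -> : a2 + t * (b2 - a2) = (1 - t) * a2 + t * b2 by ring.
have cs : a1 * b1 + a2 * b2 <= 1.
  by have := sqr_ge0 (a1 - b1); have := sqr_ge0 (a2 - b2); nra.
have u0 : 0 <= 1 - t by lra.
have h1 : (1 - t) ^+ 2 * (a1 ^+ 2 + a2 ^+ 2) <= (1 - t) ^+ 2.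
  by rewrite ler_piMr// sqr_ge0.
have h2 : t ^+ 2 * (b1 ^+ 2 + b2 ^+ 2) <= t ^+ 2 by rewrite ler_piMr// sqr_ge0.
have h3 : ((1 - t) * t) * (a1 * b1 + a2 * b2) <= (1 - t) * t.
  by rewrite ler_piMr// mulr_ge0.
nra.
Qed.

(* A triangle in the disk has a vertex mapped between the two others; the opposite
   side avoids that vertex and would be disconnected by it. *)
Lemma disk_not_in_arc psi (chi : plane -> plane) : disk_embedding psi ->
  {within disk, continuous chi} -> set_inj disk chi ->
  ~ (forall q, disk q -> exists2 y : R, disk (0, y) & chi q = psi (0, y)).
Proof.
move=> [cpsi ipsi] cchi ichi arc.
have [u uP] : {u : plane -> R & forall q, disk q ->
    disk (0, u q) /\ chi q = psi (0, u q)}.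
  apply: (@choice _ _ (fun q y => disk q -> disk (0, y) /\ chi q = psi (0, y))).
  move=> q; have [Dq|] := pselect (disk q); last by exists 0.
  by have [y] := arc _ Dq; exists y.
have uinj q r : disk q -> disk r -> u q = u r -> q = r.
  move=> Dq Dr qr; apply: ichi; rewrite ?inE//.
  by rewrite (uP _ Dq).2 (uP _ Dr).2 qr.
have psiinj y y' : disk (0, y) -> disk (0, y') -> psi (0, y) = psi (0, y') -> y = y'.
  by move=> D1 D2 /ipsi; rewrite !inE => /(_ D1 D2)[].
have mid a b m : disk a -> disk b -> disk m ->
    (forall t, 0 <= t <= 1 -> segm a b t <> m) -> u a < u m -> u m < u b -> False.
  move=> Da Db Dm mN am mb.
  (* The parts of the disk below and above height [u m] have closed images [Jl] and [Jr]. Both meet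
     [Q] and together they cover it, but they share no point of it, since [Q] lies in the arc and
     misses [chi m]. *)
  pose Q := chi @` (segm a b @` `[0, 1]).
  pose Jl := psi @` (disk `&` [set q | q.2 <= u m]).
  pose Jr := psi @` (disk `&` [set q | u m <= q.2]).
  have snd_cont : continuous (snd : plane -> R).
    by move=> q; apply: cvgsnd; exact: cvg_id.
  have cl : closed Jl.
    apply: disk_image_closed => //.
    apply: (preimage_closed (f := (snd : plane -> R)) (D := [set x | x <= u m])).
      by move=> q _; exact: snd_cont.
    exact: closed_le.
  have cr : closed Jr.
    apply: disk_image_closed => //.
    apply: (preimage_closed (f := (snd : plane -> R)) (D := [set x | u m <= x])).
      by move=> q _; exact: snd_cont.
    exact: closed_ge.
  have Qseg q : (segm a b @` `[0, 1]) q -> disk q /\ q <> m.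
    move=> [t]; rewrite /= in_itv/= => t01 <-.
    by split; [exact: disk_convex|exact: mN].
  have cQ : connected Q.
    apply: connected_continuous_connected; first exact: segm_connected.
    by apply: continuous_subspaceW cchi => q /Qseg[].
  have Q2 p : Q p -> Jl p -> Jr p -> False.
    move=> [q /Qseg[Dq qm] <-] [[x1 y1] [D1 /= le1] e1] [[x2 y2] [D2 /= le2] e2].
    have [Du quE] := uP _ Dq.
    have : (x1, y1) = (0, u q) by apply: ipsi; rewrite ?inE// e1.
    move=> [_ yE1]; have : (x2, y2) = (0, u q) by apply: ipsi; rewrite ?inE// e2.
    move=> [_ yE2]; apply: qm; apply: uinj => //; apply/eqP.
    by rewrite eq_le -{1}yE1 -yE2 le1.
  have Q1 p : Q p -> Jl p \/ Jr p.
    move=> [q /Qseg[Dq _] <-]; have [Du ->] := uP _ Dq.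
    by have [h|h] := leP (u q) (u m); [left|right]; exists (0, u q) => //;
      split => //=; exact: ltW.
  have Qa : Q (chi a) by exists a => //; exact: (segm_ends a b).1.
  have Qb : Q (chi b) by exists b => //; exact: (segm_ends a b).2.
  have QE : Q `&` Jl = Q.
    apply: cQ; last by exists Jl.
    - exists (chi a); split => //; exists (0, u a) => /=.
        by split; [exact: (uP _ Da).1|exact: ltW].
      by rewrite -(uP _ Da).2.
    - exists (~` Jr); first exact: closed_openC.
      apply/seteqP; split => p [Qp Jp]; split => //; first by move=> /(Q2 _ Qp Jp).
      by case: (Q1 _ Qp).
  apply: (Q2 (chi b)) => //; first by move: Qb; rewrite -QE => -[].
  exists (0, u b); last by rewrite -(uP _ Db).2.
  by split; [exact: (uP _ Db).1|exact: ltW].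
pose Z : plane := (0, 0); pose X : plane := (1, 0); pose Y : plane := (0, 1).
have DZ : disk Z by rewrite /unit_disk /=; lra.
have DX : disk X by rewrite /unit_disk /=; lra.
have DY : disk Y by rewrite /unit_disk /=; lra.
have segE (a b : plane) t : segm a b t = (a.1 + t * (b.1 - a.1), a.2 + t * (b.2 - a.2)).
  by [].
have ZX : u Z != u X by apply/eqP => /(uinj _ _ DZ DX)[]; lra.
have ZY : u Z != u Y by apply/eqP => /(uinj _ _ DZ DY)[]; lra.
have XY : u X != u Y by apply/eqP => /(uinj _ _ DX DY)[]; lra.
have [h1|h1|h1] := ltgtP (u Z) (u X); last by rewrite h1 eqxx in ZX.
- have [h2|h2|h2] := ltgtP (u X) (u Y); last by rewrite h2 eqxx in XY.
  + by apply: (mid Z Y X) => // t t01; rewrite segE /= => -[]; lra.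
  have [h3|h3|h3] := ltgtP (u Z) (u Y); last by rewrite h3 eqxx in ZY.
  + by apply: (mid Z X Y) => // t t01; rewrite segE /= => -[]; lra.
  + by apply: (mid Y X Z) => // t t01; rewrite segE /= => -[]; lra.
- have [h2|h2|h2] := ltgtP (u Y) (u X); last by rewrite h2 eqxx in XY.
  + by apply: (mid Y Z X) => // t t01; rewrite segE /= => -[]; lra.
  have [h3|h3|h3] := ltgtP (u Z) (u Y); last by rewrite h3 eqxx in ZY.
  + by apply: (mid X Y Z) => // t t01; rewrite segE /= => -[]; lra.
  + by apply: (mid X Z Y) => // t t01; rewrite segE /= => -[]; lra.
Qed.

End Regions.

(** * Paths that meet the boundary of a region at most once *)

Section Avoid.
Variable R : realType.
Notation plane := (R * R)%type.
Notation disk := (@unit_disk R).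
Implicit Types (phi psi : plane -> plane) (A B Q : set plane).

Lemma boundary_closed_sub A : closed A -> boundary A `<=` A.
Proof. by move=> /closure_id {2}-> p []. Qed.

(** The condition [0 < a.1 * q.1] puts [q] on the same side of the vertical diameter as [a]. This
    open half is star-shaped from [a] and its image misses the boundary of [A]. *)
Lemma half_disk_avoid psi A (a : plane) : disk_embedding psi -> closed A ->
  (forall q, disk q -> boundary A (psi q) <-> q.1 = 0) ->
  disk a -> a.1 != 0 -> ~ A (psi a) ->
  forall q, disk q -> 0 < a.1 * q.1 -> ~ A (psi q).
Proof.
move=> [cpsi _] cA bA Da a0 nAa q Dq aq.
pose H := [set q : plane | disk q /\ 0 < a.1 * q.1].
have Ha : H a by split => //; rewrite -expr2 lt_neqAle sqr_ge0 eq_sym sqrf_eq0 a0.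
have cH : connected H.
  apply: (@star_connected _ _ a) => b [Db ab] _ [t /= + <-]; rewrite in_itv/= => t01.
  split; first exact: disk_convex.
  have -> : (segm a b t).1 = a.1 + t * (b.1 - a.1) by [].
  have -> : a.1 * (a.1 + t * (b.1 - a.1)) = (1 - t) * (a.1 * a.1) + t * (a.1 * b.1).
    by ring.
  have [t0 t1] := andP t01; have [->|tn0] := eqVneq t 0.
    by rewrite subr0 mul1r mul0r addr0 Ha.2.
  apply: ltr_wpDl; first by rewrite mulr_ge0 ?subr_ge0// ltW// Ha.2.
  by rewrite mulr_gt0// lt_neqAle eq_sym tn0.
apply: (@connected_avoid_boundary _ _ (psi @` H) (psi a)) => //.
- apply: connected_continuous_connected => //.
  by apply: continuous_subspaceW cpsi => r [].
- move=> _ [r [Dr ar] <-] /bA => /(_ Dr) r0.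
  by rewrite r0 mulr0 ltxx in ar.
- by exists q.
Qed.

(** Contracting the disk that parametrizes [A] towards the preimage [p0] of the point gives an
    embedded disk inside the neighbourhood; it would lie in an arc, against [disk_not_in_arc]. *)
Lemma region_not_in_arc psi A q0 : disk_embedding psi -> simple_closed_region A ->
  A (psi q0) -> nbhs (psi q0) (psi @` disk) ->
  ~ (forall q, disk q -> A (psi q) -> q.1 = 0).
Proof.
move=> epsi [phi [[cphi iphi] ->]] [p0 Dp0 p0E] nb arc.
have crho := within_retract_disk cphi.
have [e /= e0 ballP] : exists2 e : R, 0 < e & forall q : plane,
    `|p0.1 - q.1| < e -> `|p0.2 - q.2| < e -> disk q -> (psi @` disk) (phi q).
  move: nb; rewrite -p0E => nb.
  have := crho p0 (psi @` disk); rewrite /= retract_disk_id// => /(_ nb).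
  move=> /nbhs_ballP[e /= e0 eP]; exists e => // q q1 q2 Dq.
  by have := eP q; rewrite /= retract_disk_id//; apply; split.
(* Coordinates in the disk differ by at most [2], so the contraction needs [2 * d < e], besides
   [d <= 1]. *)
pose d := e / (e + 2).
have e2 : 0 < e + 2 by lra.
have d0 : 0 < d by rewrite divr_gt0.
have d1 : d <= 1 by rewrite ler_pdivrMr//; lra.
have d2 : 2 * d < e by rewrite mulrA ltr_pdivrMr//; nra.
have d01 : 0 <= d <= 1 by rewrite d1 ltW.
have le1 (v : plane) : disk v -> -1 <= v.1 <= 1 /\ -1 <= v.2 <= 1.
  by rewrite /unit_disk /= => h; split; apply/andP; split; nra.
have [/andP[l1 u1] /andP[l2 u2]] := le1 _ Dp0.
pose chi v := (phi \o retract_disk) (segm p0 v d).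
have chiE v : disk v -> chi v = phi (segm p0 v d).
  by move=> Dv; rewrite /chi /= retract_disk_id//; exact: disk_convex.
apply: (@disk_not_in_arc _ psi chi) => //.
- apply: continuous_subspaceT => v.
  apply: (@cvg_comp _ _ _ (fun v => segm p0 v d) (phi \o retract_disk) _
    (nbhs (segm p0 v d))); last exact: crho.
  apply: cvgD; first exact: cvg_cst.
  by apply: cvgZ; [exact: cvg_cst|apply: cvgB; [exact: cvg_id|exact: cvg_cst]].
- move=> v w; rewrite !inE => Dv Dw; rewrite !chiE// => /iphi.
  rewrite !inE => /(_ (disk_convex Dp0 Dv d01) (disk_convex Dp0 Dw d01)).
  move=> /addrI /(congr1 (fun x => d^-1 *: x)).
  by rewrite !scalerA mulVf ?gt_eqF// !scale1r => /addIr.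
- move=> v Dv; have [/andP[lv1 uv1] /andP[lv2 uv2]] := le1 _ Dv.
  have [||q Dq qE] := ballP (segm p0 v d) _ _ (disk_convex Dp0 Dv d01).
  + have -> : (segm p0 v d).1 = p0.1 + d * (v.1 - p0.1) by [].
    by rewrite ltr_norml; apply/andP; split; nra.
  + have -> : (segm p0 v d).2 = p0.2 + d * (v.2 - p0.2) by [].
    by rewrite ltr_norml; apply/andP; split; nra.
  have q10 : q.1 = 0.
    by apply: arc => //; rewrite qE; exists (segm p0 v d) => //; exact: disk_convex.
  have qq : q = (0, q.2) by rewrite [LHS]surjective_pairing q10.
  by exists q.2; rewrite -qq// chiE.
Qed.

(** With no boundary point the path stays outside by connectedness. With a single one, at [t0], the
    rest of the path is outside; it alternates with the boundary, so both half disks around the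
    crossing are outside too and [A] would be reduced to an arc there. *)
Lemma path_avoids_region (gam : R -> plane) A :
  {within `[0, 1], continuous gam} -> set_inj `[0, 1] gam ->
  simple_closed_region A -> ~ A (gam 0) -> ~ A (gam 1) ->
  (forall p p', (gam @` `]0, 1[ `&` boundary A) p ->
    (gam @` `]0, 1[ `&` boundary A) p' -> p = p') ->
  (forall p, (gam @` `]0, 1[ `&` boundary A) p ->
    alternate_at (gam @` `]0, 1[) (boundary A) p) ->
  forall t, 0 <= t <= 1 -> ~ A (gam t).
Proof.
move=> cgam igam rA A0 A1 uniq alt t t01 At.
have cA := region_closed rA.
have inj r s : 0 <= r <= 1 -> 0 <= s <= 1 -> gam r = gam s -> r = s.
  by move=> r1 s1; apply: igam; rewrite inE /= in_itv.
have inner r : 0 <= r <= 1 -> boundary A (gam r) -> 0 < r < 1.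
  move=> /andP[r0 r1] /(boundary_closed_sub cA) Ar.
  rewrite !lt_neqAle r0 r1 !andbT; apply/andP; split.
    by apply/eqP => r0E; rewrite -r0E in Ar.
  by apply/eqP => r1E; rewrite r1E in Ar.
have off (i : interval R) r s : (forall x, x \in i -> 0 <= x <= 1) ->
    (forall x, x \in i -> ~ boundary A (gam x)) ->
    r \in i -> ~ A (gam r) -> s \in i -> ~ A (gam s).
  move=> i01 iN ri Ar si.
  apply: (@connected_avoid_boundary _ _ (gam @` [set` i]) (gam r)) => //.
  - apply: connected_continuous_connected.
      by apply/connected_intervalP; exact: interval_is_interval.
    by apply: continuous_subspaceW cgam => x /= /i01; rewrite in_itv.
  - by move=> _ [x xi <-]; exact: iN.
have [[t0 t0_01 bt0]|none] :=
  pselect (exists2 t0, 0 <= t0 <= 1 & boundary A (gam t0)); last first.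
  apply: (off `[0, 1]%R 0 t _ _ _ A0 _ At) => [x|x||].
  - by rewrite in_itv.
  - by rewrite in_itv/= => x01 bx; apply: none; exists x.
  - by rewrite in_itv/= lexx ler01.
  - by rewrite in_itv.
have t0i := inner _ t0_01 bt0; have [t0gt t0lt] := andP t0i.
have meet r : 0 < r < 1 -> boundary A (gam r) ->
    (gam @` `]0, 1[ `&` boundary A) (gam r).
  by move=> r01 br; split => //; exists r => //=; rewrite in_itv.
have only r : 0 <= r <= 1 -> boundary A (gam r) -> r = t0.
  move=> r01 br; apply: inj => //.
  by apply: uniq; apply: meet => //; exact: inner.
have nt r : 0 <= r <= 1 -> r != t0 -> ~ A (gam r).
  move=> /andP[r0 r1]; case: (ltgtP r t0) => // rt _.
    apply: (off `[0, t0[%R 0 r _ _ _ A0) => [x|x||].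
    - by rewrite in_itv/= => /andP[-> /ltW/le_trans]; apply; exact: ltW.
    - rewrite in_itv/= => /andP[x0 xt] bx.
      suff xE : x = t0 by rewrite xE ltxx in xt.
      by apply: only => //; rewrite x0 ltW// (lt_trans xt).
    - by rewrite in_itv/= lexx.
    - by rewrite in_itv/= r0.
  apply: (off `]t0, 1]%R 1 r _ _ _ A1) => [x|x||].
  - by rewrite in_itv/= => /andP[/ltW tx ->]; rewrite andbT (le_trans _ tx) ?ltW.
  - rewrite in_itv/= => /andP[xt x1] bx.
    suff xE : x = t0 by rewrite xE ltxx in xt.
    by apply: only => //; rewrite x1 ltW// (lt_trans _ xt).
  - by rewrite in_itv/= lexx andbT.
  - by rewrite in_itv/= rt.
have [psi [epsi psi0 nb psiP]] := alt _ (meet _ t0i bt0).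
have D0 : disk (0, 0) by exact: unit_disk0.
have Ap : A (gam t0) by exact: boundary_closed_sub.
(* The two ends of the horizontal diameter are points of the path other than the crossing, one in
   each half disk. *)
have side (x : R) : x = 1 \/ x = -1 -> ~ A (psi (x, 0)).
  move=> x1; have Dx : disk (x, 0) by rewrite /unit_disk /=; case: x1 => ->; lra.
  have [r] := ((psiP _ Dx).1.2 erefl); rewrite /= in_itv/= => r01 rE.
  rewrite -rE; apply: nt; first by have [/ltW -> /ltW ->] := andP r01.
  apply/eqP => rt; have : ((x, 0) : plane) = (0, 0).
    by apply: epsi.2; rewrite ?inE// psi0 -rt rE.
  by move=> [x0]; case: x1; lra.
apply: (@region_not_in_arc psi A (0, 0) epsi rA); rewrite ?psi0// => q Dq Aq.
have bP r : disk r -> boundary A (psi r) <-> r.1 = 0 by move=> /psiP[].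
have half x : x = 1 \/ x = -1 -> ~ 0 < x * q.1.
  move=> x1 xq; apply: (half_disk_avoid epsi cA bP _ _ (side x x1) Dq) => //=.
    by rewrite /unit_disk /=; case: x1 => ->; lra.
  by case: x1 => ->; rewrite ?oppr_eq0 oner_eq0.
have := half 1 (or_introl erefl); have := half (-1) (or_intror erefl).
by case: (ltgtP q.1 0) => // h; lra.
Qed.

End Avoid.

(** * The family *)

Definition pair5 : finType := {p : 'I_5 * 'I_5 | (p.1 < p.2)%N}.

Section BlowUp.
Variable F : finFieldType.

(** In [(e, b, k)], [e] is the bundle, [k] the edge in the bundle, and [b] tells its end in the
    cluster of smaller ([false]) or larger ([true]) index. *)
Definition bvertex : finType := (pair5 * bool * F)%type.

Implicit Types v w : bvertex.

Definition bcluster v : 'I_5 := if v.1.2 then (val v.1.1).2 else (val v.1.1).1.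

Definition bedge (x : pair5 * F) : {set bvertex} :=
  [set ((x.1, false, x.2) : bvertex); (x.1, true, x.2)]%SET.

Definition bedges : {set {set bvertex}} := [set bedge x | x in [set: pair5 * F]]%SET.

(** [None] is the root, and its children are the five clusters [Some i]. *)
Definition bparent (x : bvertex + option 'I_5) : option 'I_5 :=
  if x is inl v then Some (bcluster v) else None.

Lemma in_bedge v x : (v \in bedge x) = ((v.1.1, v.2) == x).
Proof.
case: v x => [[e b] k] [f l]; rewrite !inE /= !xpair_eqE.
by case: b; rewrite ?andbF ?andbT ?orbF.
Qed.

Lemma bedges_in x : bedge x \in bedges.
Proof. by apply/imsetP; exists x; rewrite ?inE. Qed.

Lemma bedge_inj : injective bedge.
Proof.
move=> x y xy; have := in_bedge (y.1, false, y.2) x.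
by rewrite xy in_bedge /= -surjective_pairing eqxx => /esym/eqP.
Qed.

Lemma bedges_card A : A \in bedges -> #|A| = 2%N.
Proof. by case/imsetP => x _ ->; rewrite cards2 !xpair_eqE /= andbF. Qed.

Lemma breach (mu : option 'I_5) : exists n, iter n (bparent \o inr) mu = None.
Proof. by exists 1%N. Qed.

Lemma binternal (mu : option 'I_5) :
  exists x, x <> inr (None : option 'I_5) /\ bparent x = mu.
Proof.
case: mu => [i|]; last by exists (inr (Some ord0)).
suff [v vi] : exists v, bcluster v = i by exists (inl v); rewrite /= vi.
have [i0|i0] := posnP i.
  have i1 : (i < (inord 1 : 'I_5))%N by rewrite i0 inordK.
  by exists (exist (fun p : 'I_5 * 'I_5 => (p.1 < p.2)%N) (i, inord 1) i1, false, 0).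
by exists (exist (fun p : 'I_5 * 'I_5 => (p.1 < p.2)%N) (ord0, i) i0, true, 0).
Qed.

Definition blowup : clustered_graph :=
  @ClusteredGraph bvertex bedges (option 'I_5) None bparent
    bedges_card erefl breach binternal.

Lemma blowup_ancestor (mu nu : option 'I_5) :
  @ancestor blowup mu nu = (mu == None) || (mu == nu).
Proof.
apply/idP/orP => [/iter_findex <-|[/eqP ->|/eqP ->]]; last exact: connect0.
  by case: (findex _ _ _) => [|k]; [right|left].
by apply: connect1 => /=.
Qed.

Lemma blowup_cluster v i :
  (v \in @cluster_vertices blowup (Some i)) = (bcluster v == i).
Proof. by rewrite inE blowup_ancestor /= eq_sym. Qed.

Lemma blowup_flat : flat blowup.
Proof.
by move=> mu nu muN; rewrite blowup_ancestor => /orP[/eqP//|/eqP].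
Qed.

Lemma blowup_matching : is_matching blowup.
Proof.
move=> v; exists (bedge (v.1.1, v.2)); split.
  by split; [exact: bedges_in|rewrite in_bedge].
by move=> A [/imsetP[x _ ->]]; rewrite in_bedge => /eqP <-.
Qed.

(** A bundle joins clusters of distinct indices, so no edge lies inside a cluster [Some i]; the
    cluster [Some ord0] has two vertices because [0] and [1] differ in [F]. *)
Lemma blowup_not_c_connected : ~ c_connected blowup.
Proof.
have [x [_ xE]] := binternal (Some ord0); case: x xE => // v [vE].
have cl k : (v.1, k) \in @cluster_vertices blowup (Some ord0).
  by rewrite blowup_cluster -vE.
move=> /(_ _ _ _ (cl 0) (cl 1)) /connectP[[|w p] /= ].
  by move=> _ [] /eqP; rewrite oner_eq0.
move=> /andP[/and3P[_ + /imsetP[x _ xE]] _] _; rewrite blowup_cluster => /eqP wE.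
have cl0 z : z \in bedge x -> bcluster z = ord0.
  by rewrite -xE !inE => /orP[/eqP ->|/eqP ->].
have := valP x.1; rewrite /= -[(val x.1).1]/(bcluster (x.1, false, x.2)).
rewrite -[(val x.1).2]/(bcluster (x.1, true, x.2)).
by rewrite !cl0 ?in_bedge //= -surjective_pairing.
Qed.

End BlowUp.

(** * Drawings of the blow-up *)

Lemma card_le1_eq (T : Type) (A : set T) n : A #= `I_n -> (n <= 1)%N ->
  forall x y, A x -> A y -> x = y.
Proof.
move=> /card_set_bijP[f [fA finj _]] n1 x y Ax Ay.
have lt1 z : A z -> f z = 0%N.
  by move=> /fA /= /leq_trans/(_ n1); rewrite ltnS leqn0 => /eqP.
by apply: finj; rewrite ?inE// !lt1.
Qed.

Lemma components1_connected (R : realType) (A : set (R * R)) :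
  components A #= `I_1 -> connected A.
Proof.
move=> /card_le1_eq/(_ isT) eqA.
have [[a Aa]|A0] := pselect (exists a, A a); last first.
  suff -> : A = set0 by exact: connected0.
  by apply/seteqP; split => // a Aa; case: A0; exists a.
suff -> : A = connected_component A a by exact: component_connected.
apply/seteqP; split; last exact: connected_component_sub.
move=> x Ax; rewrite (eqA (connected_component A a) (connected_component A x)).
- exact: connected_component_refl.
- by exists a.
- by exists x.
Qed.

(** The parameter is the first coordinate clamped to [[0, 1]]. The boolean [b] reverses the path,
    since the ends of an edge come in no particular order. *)
Lemma path_disk_map (R : realType) (gam : R -> R * R) (b : bool) :
  {within `[0, 1], continuous gam} ->
  exists e, [/\ disk_map e, e (0, 0) = gam b%:R, e (1, 0) = gam (~~ b)%:R &
    forall q, exists2 t, 0 <= t <= 1 & e q = gam t].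
Proof.
move=> cgam; pose cl (q : R * R) : R := Num.max 0 (Num.min 1 q.1).
pose s q := if b then 1 - cl q else cl q.
have cl01 q : 0 <= cl q <= 1.
  by rewrite /cl le_max lexx /= ge_max ler01 ge_min lexx.
have s01 q : 0 <= s q <= 1.
  by rewrite /s; case: (b); have /andP[] := cl01 q; rewrite ?subr_ge0; lra.
have ccl : continuous cl.
  move=> q; apply: (@continuous_max R _ (fun=> 0) (fun q : R * R => Num.min 1 q.1) q).
    exact: cvg_cst.
  apply: (@continuous_min R _ (fun=> 1) (fun q : R * R => q.1) q).
    exact: cvg_cst.
  by apply: cvgfst; exact: cvg_id.
have cs : continuous s.
  rewrite /s; case: (b) => q; last exact: ccl.
  by apply: cvgB; [exact: cvg_cst|exact: ccl].
have cgs : continuous (gam \o s).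
  by apply: within_comp_continuous cgam => // q; rewrite /= in_itv.
exists ((gam \o s) \o retract_disk); split.
- by apply: disk_map_retract; exact: continuous_subspaceT.
- rewrite /= retract_disk_id; last exact: unit_disk0.
  congr gam; rewrite /s /cl /= (min_r ler01) maxxx.
  by case: (b); rewrite ?subr0.
- rewrite /= retract_disk_id; last by rewrite /unit_disk /=; lra.
  congr gam; rewrite /s /cl /= minxx (max_r ler01).
  by case: (b); rewrite ?subrr.
- by move=> q; exists (s (retract_disk q)).
Qed.

Section BlowUpDrawing.
Variables (R : realType) (F : finFieldType) (D : drawing R (blowup F)).
Variable alpha : nat.
Hypothesis DP : is_alpha00_drawing D alpha.
Notation plane := (R * R)%type.

Let isD : is_drawing D. Proof. by case: DP. Qed.

Lemma region_vertexP (i : 'I_5) (v : bvertex F) :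
  dr_region D (Some i) (dr_point D v) <-> bcluster v = i.
Proof.
have := dr_region_vertices isD (Some i) v; rewrite blowup_cluster => H.
by split => [/H/eqP//|/eqP/H].
Qed.

Lemma path_point x t : 0 <= t <= 1 ->
  edge_curve D (bedge x) (dr_path D (bedge x) t) \/
  exists2 v, v \in bedge x & dr_path D (bedge x) t = dr_point D v.
Proof.
move=> /andP[t0 t1]; have ends := dr_path_ends isD (bedges_in x).
have endP p : [set dr_path D (bedge x) 0; dr_path D (bedge x) 1] p ->
    exists2 v, v \in bedge x & p = dr_point D v.
  by rewrite ends => -[v vx <-]; exists v.
have [->|tn0] := eqVneq t 0; first by right; apply: endP; left.
have [->|tn1] := eqVneq t 1; first by right; apply: endP; right.
by left; exists t => //=; rewrite in_itv/= !lt_neqAle eq_sym tn0 t0 tn1.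
Qed.

Lemma edge_avoids_region x (k : 'I_5) : k != (val x.1).1 -> k != (val x.1).2 ->
  forall t, 0 <= t <= 1 -> ~ dr_region D (Some k) (dr_path D (bedge x) t).
Proof.
move=> k1 k2; have [_ _ er _] := DP; have ex := bedges_in x.
have endN t : [set dr_path D (bedge x) 0; dr_path D (bedge x) 1]
    (dr_path D (bedge x) t) -> ~ dr_region D (Some k) (dr_path D (bedge x) t).
  rewrite (dr_path_ends isD ex) => -[v vx <-] /region_vertexP vk.
  move: vx k1 k2; rewrite /= in_bedge -vk /bcluster => /eqP <- /=.
  by case: ifP; rewrite eqxx.
apply: path_avoids_region.
- exact: (dr_path_continuous isD).
- exact: (dr_path_inj isD).
- exact: (dr_region_simple isD).
- by apply: endN; left.
- by apply: endN; right.
(* From [0 = n./2] the edge meets the boundary in at most one point. *)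
- have [n [nE n2]] := er _ (Some k) ex; apply: (card_le1_eq nE); lia.
- move=> p pP; exact: (@dr_alternate _ _ _ isD (inl (bedge x)) (inr (Some k))).
Qed.

Lemma bundle_choice_crosses (kap : pair5 -> F) : exists e f p,
  e <> f /\ edge_curve D (bedge (e, kap e)) p /\ edge_curve D (bedge (f, kap f)) p.
Proof.
apply: contrapT => none.
have [_ _ _ rr] := DP.
have [phi phiP] : {phi : nat -> plane -> plane & forall i,
    disk_embedding (phi i) /\
    dr_region D (Some (inord i)) = phi i @` @unit_disk R}.
  apply: (@choice _ _ (fun i f => disk_embedding f /\
    dr_region D (Some (inord i)) = f @` @unit_disk R)) => i.
  by have [f [? ?]] := dr_region_simple isD (Some (inord i)); exists f.
have e0 : pair5.
  exact: (exist (fun p : 'I_5 * 'I_5 => (p.1 < p.2)%N)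
    (@Ordinal 5 0 isT, @Ordinal 5 1 isT) isT).
pose E i j : pair5 := insubd e0 (inord i, inord j).
have EE i j : (i < j < 5)%N -> val (E i j) = (inord i, inord j).
  move=> /andP[ij j5]; rewrite val_insubd /= !inordK ?ij//.
  exact: ltn_trans j5.
pose X i j := (E i j, kap (E i j)).
(* The end in cluster [i] of the edge chosen between clusters [i] and [j], in either order of the
   indices. *)
pose V i j : bvertex F :=
  if (i < j)%N then (E i j, false, kap (E i j)) else (E j i, true, kap (E j i)).
have VP i j : (i < 5)%N -> (j < 5)%N -> i != j -> bcluster (V i j) = inord i.
  rewrite /V /bcluster => i5 j5; case: (ltngtP i j) => // ij _ /=; rewrite EE//= ij//.
pose pt i j := dr_point D (V i j).
have [x xP] : {x : nat * nat -> plane & forall ij, (ij.1 < 5)%N -> (ij.2 < 5)%N ->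
    ij.1 != ij.2 -> unit_disk (x ij) /\ phi ij.1 (x ij) = pt ij.1 ij.2}.
  apply: (@choice _ _ (fun ij q => (ij.1 < 5)%N -> (ij.2 < 5)%N ->
    ij.1 != ij.2 -> unit_disk q /\ phi ij.1 q = pt ij.1 ij.2)) => -[i j] /=.
  have [/and3P[i5 j5 ij]|N] := boolP [&& i < 5, j < 5 & i != j]%N; last first.
    by exists 0 => i5 j5 ij; case/negP: N; apply/and3P.
  have [q Dq qE] : (phi i @` @unit_disk R) (pt i j).
    by rewrite -(phiP i).2; apply/region_vertexP; exact: VP.
  by exists q.
have [e eP] : {e : nat * nat -> plane -> plane & forall ij, (ij.1 < ij.2 < 5)%N ->
    [/\ disk_map (e ij), e ij (0, 0) = pt ij.1 ij.2, e ij (1, 0) = pt ij.2 ij.1 &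
     forall q, exists2 t, 0 <= t <= 1 &
       e ij q = dr_path D (bedge (X ij.1 ij.2)) t]}.
  apply: (@choice _ _ (fun ij e => (ij.1 < ij.2 < 5)%N ->
    [/\ disk_map e, e (0, 0) = pt ij.1 ij.2, e (1, 0) = pt ij.2 ij.1 &
     forall q, exists2 t, 0 <= t <= 1 &
       e q = dr_path D (bedge (X ij.1 ij.2)) t])) => -[i j] /=.
  have [ij|N] := boolP (i < j < 5)%N; last by exists id.
  have ex := bedges_in (X i j).
  have cp := dr_path_continuous isD ex.
  have [ij' j5] := andP ij.
  have VX v : v \in bedge (X i j) -> v = V i j \/ v = V j i.
    rewrite /V ij' ltnNge (ltnW ij') /= !inE => /orP[/eqP ->|/eqP ->];
    by [left|right].
  have ends := dr_path_ends isD ex.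
  have pij : pt i j <> pt j i.
    by move=> /(dr_point_inj isD); rewrite /V ij' ltnNge (ltnW ij').
  have inX v : v = V i j \/ v = V j i ->
      [set dr_path D (bedge (X i j)) 0; dr_path D (bedge (X i j)) 1] (dr_point D v).
    rewrite ends /V ij' ltnNge (ltnW ij') /= => vE; exists v => //=.
    by rewrite !inE; case: vE => ->; rewrite eqxx ?orbT.
  have [b [b0 b1]] : exists b : bool, dr_path D (bedge (X i j)) b%:R = pt i j /\
      dr_path D (bedge (X i j)) (~~ b)%:R = pt j i.
    have [h0|h0] := inX _ (or_introl erefl); have [h1|h1] := inX _ (or_intror erefl).
    - by case: pij; rewrite /pt h0 h1.
    - by exists false; rewrite /pt h0 h1.
    - by exists true; rewrite /pt h0 h1.
    - by case: pij; rewrite /pt h0 h1.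
  by have [g [g1 g2 g3 g4]] := path_disk_map b cp; exists g; rewrite -b0 -b1.
(* Any index other than [i]: the vertex [i] of [K_5] is placed at the end in cluster [i] of the edge
   chosen towards cluster [o i]. *)
pose o i := if i == 0%N then 1%N else 0%N.
have oP i : (i < 5)%N -> (o i < 5)%N /\ i != o i by case: i => [|i].
pose g i := phi i \o retract_disk.
have gA i q : dr_region D (Some (inord i)) (g i q).
  by rewrite (phiP i).2; exists (retract_disk q) => //; exact: retract_disk_in.
have gx i j : (i < 5)%N -> (j < 5)%N -> i != j -> g i (x (i, j)) = pt i j.
  move=> i5 j5 ij; have [Dx xE] := xP (i, j) i5 j5 ij.
  by rewrite /g /= retract_disk_id.
have ord_neq i j : (i < 5)%N -> (j < 5)%N -> i != j ->
    (inord i : 'I_5) != inord j.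
  by move=> i5 j5; apply: contra => /eqP/(congr1 val); rewrite /= !inordK// => ->.
have ptN i j k s : (i < 5)%N -> (j < 5)%N -> (k < 5)%N -> i != j -> i != k ->
    pt i j <> g k s.
  move=> i5 j5 k5 ij ik h; have := gA k s; rewrite -h => /region_vertexP.
  by rewrite VP//; apply/eqP; exact: ord_neq.
apply: (@K5_disks_meet R g (fun i => x (i, o i)) (fun i j => x (i, j))
  (fun i j => e (i, j)) (0, 0) (1, 0)).
- by move=> i _; apply: disk_map_retract; have [[? _] _] := phiP i.
- by move=> i j /(eP (i, j))[].
- by move=> i i5; have [ho io] := oP i i5; have [] := xP (i, o i) i5 ho io.
- by move=> i j i5 j5 ij; have [] := xP (i, j) i5 j5 ij.
- move=> i j ij; case: (eP (i, j) ij) => _ -> -> _.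
  have [ij' j5] := andP ij; have i5 := ltn_trans ij' j5.
  by rewrite !gx// ?(ltn_eqF ij')// gtn_eqF.
- move=> i k i5 k5 ik s; have [ho io] := oP i i5; rewrite gx//.
  exact: ptN.
- by move=> i j k i5 j5 k5 ij ik s; rewrite gx//; exact: ptN.
- move=> i k i5 k5 ik; have [emb regE] := phiP i.
  have := rr (Some (inord i)) (Some (inord k)).
  rewrite !blowup_ancestor /= !(inj_eq Some_inj) ord_neq// ord_neq 1?eq_sym// .
  move=> /(_ isT isT)/components1_connected cB.
  have := embedding_preimage_connected emb _ cB.
  rewrite -regE => /(_ (@subDsetl _ _ _)).
  rewrite (_ : [set s | _] = [set s | @unit_disk R s /\ forall t, g i s <> g k t])//.
  apply/seteqP; split => s /= [Ds].
    move=> [_ sN]; split => // t st; apply: sN.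
    by move: st; rewrite {1}/g /= retract_disk_id// => ->.
  move=> sN; split => //; split; first by rewrite regE; exists s.
  rewrite (phiP k).2 => -[t Dt tE]; apply: (sN t).
  by rewrite /g /= !retract_disk_id.
- move=> i j k q s ij k5 ki kj h.
  have [ij' j5] := andP ij; have i5 := ltn_trans ij' j5.
  have [_ _ _ /(_ q)[t t01 qE]] := eP (i, j) ij.
  apply: (@edge_avoids_region (X i j) (inord k) _ _ t t01).
  + by rewrite /= EE//=; exact: ord_neq.
  + by rewrite /= EE//=; exact: ord_neq.
  by rewrite -[dr_path _ _ _]qE h.
- move=> i j k l q s ij kl U h.
  have [_ _ _ /(_ q)[t t01 qE]] := eP (i, j) ij.
  have [_ _ _ /(_ s)[r r01 sE]] := eP (k, l) kl.
  have XN : E i j <> E k l.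
    move=> /(congr1 val); rewrite !EE// => -[/(congr1 val) + _].
    have [ij' j5] := andP ij; have i5 := ltn_trans ij' j5.
    have [kl' l5] := andP kl; have k5 := ltn_trans kl' l5.
    rewrite /= !inordK// => ik.
    by move: U; rewrite ik /= !inE eqxx !orbT.
  move: qE; rewrite h sE /= => {sE} h'.
  (* A common point interior to both edges is a crossing, excluded by [none]; edges pass through no
     vertex, and two chosen edges share no end. *)
  have [c1|[v vX vE]] := path_point (X i j) t01;
    have [c2|[w wX wE]] := path_point (X k l) r01.
  + apply: none; exists (E i j), (E k l); eexists; split => //.
    by split; [exact: c1|rewrite -h'].
  + by apply: (@dr_path_avoid _ _ _ isD _ w (bedges_in (X i j))); rewrite -wE h'.
  + by apply: (@dr_path_avoid _ _ _ isD _ v (bedges_in (X k l))); rewrite -vE -h'.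
  + have /(dr_point_inj isD) vw : dr_point D v = dr_point D w by rewrite -vE -wE.
    move: vX wX; rewrite vw !in_bedge => /eqP -> /eqP[].
    by move=> XE _; apply: XN.
Qed.

End BlowUpDrawing.

(** * Counting the crossings *)

Lemma blowup_crossings_ge (R : realType) (F : finFieldType)
    (D : drawing R (blowup F)) (alpha : nat) : (#|pair5| <= #|F|)%N ->
  is_alpha00_drawing D alpha -> (#|F| ^ 2 <= alpha)%N.
Proof.
move=> leF DP; have [isD cross _ _] := DP.
(* Distinct slopes for the bundles; this is where [F] has to be large enough. *)
have [r rinj] : exists r : pair5 -> F, injective r.
  exists (fun e => enum_val (widen_ord leF (enum_rank e))) => e f /enum_val_inj.
  by move=> /(congr1 val) /= /val_inj/enum_rank_inj.
pose kap (z : F * F) e := z.1 + r e * z.2.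
pose through z p := exists e f, [/\ e <> f, edge_curve D (bedge (e, kap z e)) p &
  edge_curve D (bedge (f, kap z f)) p].
have [h hP] : {h : F * F -> R * R & forall z, through z (h z)}.
  apply: choice => z; have [e [f [p [ef [ep fp]]]]] := bundle_choice_crosses DP (kap z).
  by exists p, e, f.
have neq z e f : e <> f -> bedge (e, kap z e) <> bedge (f, kap z f).
  by move=> ef /bedge_inj[].
have one_of p x y z : x <> y -> edge_curve D (bedge x) p ->
    edge_curve D (bedge y) p -> edge_curve D (bedge z) p -> z = x \/ z = y.
  move=> xy xp yp zp; have [|zx] := eqVneq z x; first by left.
  have [|zy] := eqVneq z y; first by right.
  have bneq s t : s <> t -> inl (bedge s) <> inl (bedge t) :> _ + cg_cluster (blowup F).
    by move=> st [] /bedge_inj.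
  case: (@dr_no_three _ _ _ isD (inl (bedge x)) (inl (bedge y)) (inl (bedge z)) p);
    do ?exact: bedges_in; do ?apply: bneq => //.
  - by move=> xz; rewrite xz eqxx in zx.
  - by move=> yz; rewrite yz eqxx in zy.
  - by split.
(* Two values determine an affine function, as the slopes [r e] and [r f] differ. *)
have agree z z' e f : e <> f -> kap z e = kap z' e -> kap z f = kap z' f -> z = z'.
  case: z z' => [x y] [x' y']; rewrite /kap /= => ef he hf.
  have : (r e - r f) * (y - y') = 0.
    have -> : (r e - r f) * (y - y') =
      (x + r e * y) - (x' + r e * y') - ((x + r f * y) - (x' + r f * y')) by ring.
    by rewrite he hf !subrr.
  move=> /eqP; rewrite mulf_eq0 !subr_eq0 (inj_eq rinj) => /orP[/eqP//|/eqP yy].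
  by move: he; rewrite yy => /addIr ->.
have hinj : injective h.
  move=> z z' zz'.
  have [e [f [ef ep fp]]] := hP z; have [e' [f' [ef' ep' fp']]] := hP z'.
  rewrite -zz' in ep' fp'.
  have EF : (e, kap z e) <> (f, kap z f) by case.
  (* At the common point the edges for [z'] are among the two for [z]. They come from distinct
     bundles, so they are the same two, in one order or the other. *)
  case: (one_of _ _ _ _ EF ep fp ep') => -[eE kE];
    case: (one_of _ _ _ _ EF ep fp fp') => -[fE lE];
    rewrite eE in ef' kE; rewrite fE in ef' lE => //.
  - exact: (agree _ _ e f ef (esym kE) (esym lE)).
  - exact: (agree _ _ e f ef (esym lE) (esym kE)).
have /card_set_bijP[c [cX cinj _]] := cross.
have hX z : [set p | exists e f, [/\ e \in cg_edges (blowup F),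
    f \in cg_edges (blowup F), e <> f & (edge_curve D e `&` edge_curve D f) p]] (h z).
  have [e [f [ef ep fp]]] := hP z.
  exists (bedge (e, kap z e)), (bedge (f, kap z f)).
  by split; [exact: bedges_in|exact: bedges_in|exact: neq|].
pose num z : 'I_alpha := Ordinal (cX _ (hX z)).
have numinj : injective num.
  by move=> z z' /(congr1 val) /= /cinj; rewrite !inE => /(_ (hX z) (hX z'))/hinj.
by have := leq_card num numinj; rewrite card_prod card_ord mulnn.
Qed.

Lemma blowup_num_vertices (F : finFieldType) :
  num_vertices (blowup F) = (#|pair5| * 2 * #|F|)%N.
Proof. by rewrite /num_vertices !card_prod card_bool. Qed.

Theorem theorem8 (R : realType) :
  exists C : nat -> clustered_graph,
    [/\ (forall i, ~ c_connected (C i) /\ flat (C i) /\ is_matching (C i)),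
        (forall N : nat, exists i, (N <= num_vertices (C i))%N) &
        exists (c : R) (n0 : nat), 0 < c /\
          forall i (alpha : nat) (D : drawing R (C i)),
            (n0 <= num_vertices (C i))%N -> is_alpha00_drawing D alpha ->
            c * (num_vertices (C i))%:R ^+ 2 <= alpha%:R].
Proof.
(* In the bound on [p i], the term [i] makes the graphs arbitrarily large and [#|pair5|] provides
   enough slopes. *)
have [p pP] : {p : nat -> nat & forall i, (i + #|pair5| < p i)%N /\ prime (p i)}.
  apply: (@choice _ _ (fun i p => (i + #|pair5| < p)%N /\ prime p)) => i.
  by have [p] := prime_above (i + #|pair5|); exists p.
have cardF i : #|'F_(p i)| = p i by rewrite card_Fp ?(pP i).2.
have pair_gt0 : (0 < #|pair5|)%N.
  apply/card_gt0P.
  by exists (exist (fun q : 'I_5 * 'I_5 => (q.1 < q.2)%N)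
    (@Ordinal 5 0 isT, @Ordinal 5 1 isT) isT).
exists (fun i => blowup 'F_(p i)); split.
- move=> i; split; first exact: blowup_not_c_connected.
  by split; [exact: blowup_flat|exact: blowup_matching].
- move=> N; exists N; rewrite blowup_num_vertices cardF.
  have [lt _] := pP N; apply: leq_trans (_ : p N <= _)%N.
    by apply: ltnW; apply: leq_ltn_trans lt; exact: leq_addr.
  by rewrite leq_pmull// muln_gt0 pair_gt0.
(* The number of vertices is [#|pair5| * 2 * p i], so this constant turns its square into [p i ^ 2],
   for every [i]. *)
exists ((#|pair5| * 2)%:R ^- 2), 0%N; split.
  by rewrite invr_gt0 exprn_gt0// ltr0n muln_gt0 pair_gt0.
move=> i alpha D _ DP; rewrite blowup_num_vertices (natrM _ (#|pair5| * 2)) exprMn mulKf; last first.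
  by rewrite expf_neq0// pnatr_eq0 -lt0n muln_gt0 pair_gt0.
rewrite -natrX ler_nat; apply: blowup_crossings_ge DP.
rewrite cardF; have [lt _] := pP i.
by apply: ltnW; apply: leq_ltn_trans lt; exact: leq_addl.
Qed.
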